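(* Let $\delta\in(0,1)$. For every $t\ge 1$ let $\psi=\psi_{t,\delta}$ be a number with $\psi_{t,\delta}\ge 2^{30}\log^4(5t/\delta)$, and run the algorithm OSE with the tuning parameters $\beta_t=6\log(5t/\delta)$. Then, with probability at least $1-\delta$, for all $t\ge 1$ the recommendation $\hat r_t$ of OSE satisfies $$\gamma(\hat r_t)\le \eta^*_t(\psi_{t,\delta}).$$ This implies in particular that $\lambda_{\gamma(\hat r_t)}\ge \lambda_{\eta^*_t(\psi_{t,\delta})}$.
   Context: **Model.** The set of arms is $\mathcal A=\{1,2,\dots\}$. The function $\eta\mapsto\lambda_\eta$ from $(0,1]$ to $\mathbb R$ is nonincreasing and right-continuous (it may tend to $+\infty$ as $\eta\to0$). The ranks $(\gamma(a))_{a\ge1}$ are independent and uniform on $[0,1]$. Arm $a$ produces rewards $X_{a,s}=\lambda_{\gamma(a)}+\varepsilon_{a,s}$, $s\ge1$, where the noise variables $\varepsilon_{a,s}$ are independent (over all $a,s$, and independent of the ranks), centered, and $\zeta^2$-sub-Gaussian: $\mathbb E[e^{\theta\varepsilon_{a,s}}]\le \exp(\zeta^2\theta^2/2)$ for all $\theta\in\mathbb R$, with $\zeta>0$. At each time $t=1,2,\dots$ the learner pulls one arm $\hat a_t$, chosen from past observations (and independent internal randomness), and observes $X_{\hat a_t,N_{\hat a_t,t}}$, where $N_{a,t}=\sum_{t'=1}^t\mathbf 1\{\hat a_{t'}=a\}$. It then outputs a recommendation $\hat r_t\in\mathcal A$. The learner does not know the ranks or the function $\lambda$. **Confidence bounds.**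 With $\overline X_{a,t}=\frac1{N_{a,t}}\sum_{s=1}^{N_{a,t}}X_{a,s}$, set $\mathrm{UCB}_{a,t}=\overline X_{a,t}+\sqrt{\zeta^2\beta_t/N_{a,t}}$ and $\mathrm{LCB}_{a,t}=\overline X_{a,t}-\sqrt{\zeta^2\beta_t/N_{a,t}}$. If $N_{a,t}=0$, set $\mathrm{UCB}_{a,t}=+\infty$ and $\mathrm{LCB}_{a,t}=-\infty$. **Algorithm OSE** (Optimistic Scope Exploration). At each time $t=1,2,\dots$: draw $U_t\sim\mathcal U(0,1)$ independently of everything else; set $Z_t=\lfloor t^{U_t}\rfloor$; pull $\hat a_t\in\arg\max_{a\le Z_t}\mathrm{UCB}_{a,t-1}$; recommend $\hat r_t\in\arg\max_{a\in\mathcal A}\mathrm{LCB}_{a,t}$. Among unsampled arms, the one with smallest index is pulled first, so that the sampled arms always form an initial segment of $\{1,2,\dots\}$. **Sample complexity.** For $0<\rho<\nu\le1$, $$G(\rho,\nu)=\max\Big(\frac{\zeta^2\nu}{\rho(\lambda_\rho-\lambda_\nu)^2},\ \frac1\rho\Big),$$ with $G(\rho,\nu)=+\infty$ if $\lambda_\rho=\lambda_\nu$. For $\eta\in(0,1]$, $S(\eta)=\inf_{0<\rho<\eta}\ \sup_{\eta\le\nu\le1}G(\rho,\nu)$. For $\psi>0$ and $t\ge1$, $$\eta^*_t(\psi)=\inf\{\eta\in(0,1):\ S(\eta)\le t/\psi\},$$ with the convention that this equals $1$ when the set is empty. $\log$ is the natural logarithm. *)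

(* Defs.v *)
From HB Require Import structures.
From mathcomp Require Import all_boot all_order all_algebra finmap.
From mathcomp Require Import all_classical all_reals all_analysis.
Import Order.TTheory GRing.Theory Num.Theory.
Import numFieldNormedType.Exports.

Set Implicit Arguments.
Unset Strict Implicit.
Unset Printing Implicit Defensive.

Local Open Scope classical_set_scope.
Local Open Scope ring_scope.

(* Arms, times and sample numbers are all counted from 1; the values of the
   families below at index 0 are never used. *)

Definition is_argmax {R : realType} (D : set nat) (f : nat -> \bar R)
    (a : nat) : Prop :=
  D a /\ forall b, D b -> (f b <= f a)%E.

(* One realization of a run. [x a s] is the s-th reward of arm a and [p t] is
   the arm pulled at time t. *)
Section path.
Context {R : realType} (zeta : R) (beta : nat -> R).
Implicit Types (x : nat -> nat -> R) (p r : nat -> nat) (u : nat -> R).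

Definition npulls p (a t : nat) : nat :=
  (\sum_(1 <= t' < t.+1) (p t' == a))%N.

Definition emp_mean x p (a t : nat) : R :=
  (\sum_(1 <= s < (npulls p a t).+1) x a s) / (npulls p a t)%:R.

Definition width p (a t : nat) : R :=
  Num.sqrt (zeta ^+ 2 * beta t / (npulls p a t)%:R).

Definition UCB x p (a t : nat) : \bar R :=
  if npulls p a t == 0%N then +oo%E else (emp_mean x p a t + width p a t)%:E.

Definition LCB x p (a t : nat) : \bar R :=
  if npulls p a t == 0%N then -oo%E else (emp_mean x p a t - width p a t)%:E.

Definition scope u (t : nat) : nat := Num.truncn (t%:R `^ u t).

(* The pulls [p] and the recommendations [r] comply with OSE; ties between
   sampled arms may be broken in any way. *)
Definition OSE_path x u p r : Prop :=
  forall t : nat, (0 < t)%N ->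
    [/\ is_argmax [set a | (1 <= a <= scope u t)%N]
          (fun a => UCB x p a t.-1) (p t),
        npulls p (p t) t.-1 = 0%N ->
          forall a, (1 <= a < p t)%N -> (0 < npulls p a t.-1)%N
      & is_argmax [set a | (1 <= a)%N] (fun a => LCB x p a t) (r t)].

End path.

Section sample_complexity.
Context {R : realType} (zeta : R) (lambda : R -> R).

Definition gap_cost (rho nu : R) : \bar R :=
  if lambda rho == lambda nu then +oo%E
  else (Num.max (zeta ^+ 2 * nu / (rho * (lambda rho - lambda nu) ^+ 2))
                (rho^-1))%:E.

Definition sample_cost (eta : R) : \bar R :=
  ereal_inf [set ereal_sup [set gap_cost rho nu | nu in `[eta, 1]]
            | rho in `]0, eta[ ].

Definition reachable (psi : R) (t : nat) : set R :=
  [set eta | 0 < eta < 1 /\ (sample_cost eta <= (t%:R / psi)%:E)%E].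

(* The case distinction is needed because [inf set0 = 0]. *)
Definition eta_star (psi : R) (t : nat) : R :=
  if `[< reachable psi t = set0 >] then 1 else inf (reachable psi t).

End sample_complexity.

Section probability.
Context {d : measure_display} {T : measurableType d} {R : realType}.
Variable P : probability T R.

Definition sigma_of {d'} {T' : measurableType d'} (f : T -> T') : set (set T) :=
  preimage_set_system setT f measurable.

Definition mutually_independent {I : choiceType} (F : I -> set (set T)) : Prop :=
  forall (J : {fset I}) (A : I -> set T),
    (forall i, i \in J -> F i (A i)) ->
    P (\bigcap_(i in [set` J]) A i) = (\prod_(i <- J) P (A i))%E.

Definition uniform01 (X : {RV P >-> R}) : Prop :=
  forall A : set R, measurable A -> distribution P X A = uniform_prob (@ltr01 R) A.

Definition subgaussian (zeta : R) (X : {RV P >-> R}) : Prop :=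
  forall theta : R,
    ('E_P[fun w => expR (theta * X w)]
       <= (expR (zeta ^+ 2 * theta ^+ 2 / 2))%:E)%E.

(* The elementary sources of randomness: the ranks, the noise, the uniform draws
   of OSE, and a seed carrying any further internal randomization (such as
   randomized tie-breaking). *)
Definition sources {dW} {W : measurableType dW} (gamma : nat -> {RV P >-> R})
    (eps : nat -> nat -> {RV P >-> R}) (U : nat -> {RV P >-> R})
    (seed : {RV P >-> W}) (i : nat + nat * nat + nat + unit) : set (set T) :=
  match i with
  | inl (inl (inl a)) => sigma_of (gamma a.+1)
  | inl (inl (inr (a, s))) => sigma_of (eps a.+1 s.+1)
  | inl (inr t) => sigma_of (U t.+1)
  | inr _ => sigma_of seed
  end.

Definition reward (lambda : R -> R) (gamma : nat -> T -> R)
    (eps : nat -> nat -> T -> R) (w : T) (a s : nat) : R :=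
  lambda (gamma a w) + eps a s w.

Definition observation (x : T -> nat -> nat -> R) (p : nat -> T -> nat)
    (t : nat) (w : T) : R :=
  x w (p t w) (npulls (p ^~ w) (p t w) t).

(* What the learner knows after its first m uniform draws and n pulls. *)
Definition information {dW} {W : measurableType dW} (seed : T -> W)
    (U : nat -> T -> R) (x : T -> nat -> nat -> R) (p : nat -> T -> nat)
    (m n : nat) : set (set T) :=
  <<s sigma_of seed
      `|` \bigcup_(t in [set t | (1 <= t <= m)%N]) sigma_of (U t)
      `|` \bigcup_(t in [set t | (1 <= t <= n)%N])
            (sigma_of (p t) `|` sigma_of (observation x p t)) >>.

(* The compliance with OSE is only required almost surely, because [U t] may
   leave ]0, 1[ on a null set. *)
Definition OSE_run {dW} {W : measurableType dW} (zeta : R) (beta : nat -> R)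
    (seed : T -> W) (U : nat -> T -> R) (x : T -> nat -> nat -> R)
    (p r : nat -> T -> nat) : Prop :=
  [/\ forall t, (0 < t)%N -> sigma_of (p t) `<=` information seed U x p t t.-1,
      forall t, (0 < t)%N -> sigma_of (r t) `<=` information seed U x p t t
    & {ae P, forall w, OSE_path zeta beta (x w) (U ^~ w) (p ^~ w) (r ^~ w)}].

End probability.

(* Main.v *)
Require Import Defs.
From HB Require Import structures.
From mathcomp Require Import all_boot all_order all_algebra finmap.
From mathcomp Require Import all_classical all_reals all_analysis.
From mathcomp Require Import measurable_realfun ring lra zify.
Import Order.TTheory GRing.Theory Num.Theory.
Import numFieldNormedType.Exports.

Set Implicit Arguments.
Unset Strict Implicit.
Unset Printing Implicit Defensive.

Local Open Scope classical_set_scope.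
Local Open Scope ring_scope.

(** Fix a time t, put l = ln (5 t / delta), so that beta_t = 6 l, and suppose
    that the recommended rank exceeded a reachable eta. Then there is a
    benchmark rank rho < eta whose gap cost is at most 2 t / psi_t against every
    rank in [eta, 1]; in particular 1 / rho is at most 2 t / psi_t. Up to a
    factor 2, rho is dyadic, say 2^-J, and only three typical properties of the
    first 2 k arms, with k close to 3 l 2^J, are needed.
    - One of the first k arms has rank at most 2^-J.
    - The scope Z_s = floor (s^U_s) has a logarithm spread evenly over
      [0, ln s], so it lies in [k, 2 k) at least t / (16 l) times up to t.
    - The sum over a < 2 k of 2^-J / max (gamma_a, 2^-J) is O(l^2), because
      1 / max (gamma, 2^-J) has mean O(J) and J = O(l).

    At a time of the second kind the pulled arm a has an upper confidence bound
    above that of a benchmark arm, hence above lambda_rho. If gamma_a >= eta,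
    this bounds the past pulls of a through its own gap. If gamma_a < eta and a
    has many pulls, its lower confidence bound is not far below lambda_rho, so
    that the recommended arm, whose lower bound is larger still, has a mean not
    far below lambda_rho; this bounds the past pulls of a through the gap of the
    recommended arm, whose rank is larger than gamma_a. In both cases a has at
    most O(l t / psi_t) 2^-J / max (gamma_a, 2^-J) past pulls
    ([pulls_rank_weight]). Summing over a < 2 k, the scope lies in [k, 2 k) only
    O(k + l^3 t / psi_t) times, which is less than t / (16 l) as soon as psi_t is
    at least 2^30 l^4: a contradiction ([recommendation_rank]).

    The typical properties and the confidence bounds concern the ranks, the
    noise and the uniform draws alone, and not the adaptive run, so that
    Chernoff bounds for independent variables suffice ([chernoff]). Each fails
    with probability O((delta / t)^3) ([scale_failure_prob],
    [noise_failure_prob]). There are O(t) of them per time: scales J with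
    2^J <= t, and pairs of an arm a and a number n of its pulls with
    max (a, n) = t, since an interval that is valid when beta is taken at
    max (a, n) stays valid later. The sum over t is at most delta. *)

Import HBNNSimple.

(** * Expectations of products of independent variables *)

(** Obtained by splitting the simple function [g] along its level sets. *)
Lemma integral_simple_weight (R : realType) (d : measure_display)
  (T : measurableType d) (P : {measure set T -> \bar R}) (F : T -> R)
  (g : {nnsfun R >-> R}) (H : T -> R) :
  measurable_fun setT F -> measurable_fun setT H -> (forall w, 0 <= H w) ->
  (\int[P]_w (g (F w) * H w)%:E =
   \sum_(y \in range g) y%:E *
     \int[P]_w (\1_(F @^-1` (g @^-1` [set y])) w * H w)%:E)%E.
Proof.
move=> mF mH H0.
transitivity (\int[P]_w (\sum_(y \in range g)
   y%:E * (\1_(F @^-1` (g @^-1` [set y])) w * H w)%:E))%E.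
  apply: eq_integral => w _.
  rewrite EFinM (fimfunE g) -fsumEFin// ge0_mule_fsuml => [|y]; last first.
    exact: nnfun_muleindic_ge0.
  by apply: eq_fsbigr => y _; rewrite !EFinM muleA.
have mind y : measurable_fun setT
    (fun w => (\1_(F @^-1` (g @^-1` [set y])) w * H w)%:E).
  apply/measurable_EFinP; apply: measurable_funM => //.
  apply: measurable_indic; rewrite -[X in measurable X]setTI.
  by apply: mF => //; rewrite -[X in measurable X]setTI; exact: measurable_funP.
rewrite ge0_integral_fsum//.
- apply: eq_fsbigr => y; rewrite inE => -[z _ <-].
  by rewrite ge0_integralZl// => [w _|]; [rewrite lee_fin mulr_ge0|rewrite lee_fin].
- by move=> y; apply: measurable_funeM.
- move=> y w _; rewrite EFinM muleA; apply: mule_ge0; last by rewrite lee_fin.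
  rewrite -EFinM; exact: (nnfun_muleindic_ge0 g y (F w)).
Qed.

(** Weights [H] and [H'] with the same integral over every set of the
    sigma-algebra of [F] are indistinguishable for functions of [F]: this is
    clear for simple functions of [F] and passes to monotone limits. It is how
    one factor at a time is integrated out of a product of independent
    factors. *)
Lemma eq_integral_weight (R : realType) (d : measure_display)
  (T : measurableType d) (P : {measure set T -> \bar R}) (F H H' : T -> R) :
  measurable_fun setT F -> (forall w, 0 <= F w) ->
  measurable_fun setT H -> (forall w, 0 <= H w) ->
  measurable_fun setT H' -> (forall w, 0 <= H' w) ->
  (forall B : set R, measurable B ->
     \int[P]_w (\1_(F @^-1` B) w * H w)%:E =
     \int[P]_w (\1_(F @^-1` B) w * H' w)%:E)%E ->
  (\int[P]_w (F w * H w)%:E = \int[P]_w (F w * H' w)%:E)%E.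
Proof.
move=> mF F0 mH H0 mH' H'0 HH'.
have mpos : measurable_fun setT (fun x : R => (Num.max x 0)%:E).
  by apply/measurable_EFinP; apply: measurable_maxr => //; exact: measurable_id.
pose h := nnsfun_approx measurableT mpos.
have lim_weight (K : T -> R) : measurable_fun setT K -> (forall w, 0 <= K w) ->
    (\int[P]_w (F w * K w)%:E =
     limn (fun n => \int[P]_w (h n (F w) * K w)%:E))%E.
  move=> mK K0; rewrite -monotone_convergence//.
  - apply: eq_integral => w _; apply/esym/cvg_lim => //.
    under eq_fun do rewrite EFinM.
    rewrite (EFinM (F w) (K w)).
    apply: cvgeZr => //.
    have -> : (F w)%:E = (Num.max (F w) 0)%:E by rewrite (elimT max_idPl).
    have pos0 x : setT x -> (0 <= (Num.max x 0 : R)%:E)%E.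
      by rewrite lee_fin le_max lexx orbT.
    exact: (@cvg_nnsfun_approx _ _ _ _ measurableT _ mpos pos0 (F w) I).
  - move=> n; apply/measurable_EFinP; apply: measurable_funM => //.
    by apply: measurableT_comp => //.
  - by move=> n w _; rewrite lee_fin mulr_ge0.
  - move=> w _ a b ab; rewrite lee_fin ler_wpM2r//.
    exact/lefP/nd_nnsfun_approx.
rewrite !lim_weight//; congr (limn _); apply/funext => n.
rewrite !integral_simple_weight//; apply: eq_fsbigr => y _; congr (_ * _)%E.
by apply: HH'; rewrite -[X in measurable X]setTI; exact: measurable_funP.
Qed.

Lemma mutually_independent_seq (R : realType) (d : measure_display)
  (T : measurableType d) (P : probability T R) (I : choiceType)
  (G : I -> set (set T)) (s : seq I) (A : I -> set T) :
  mutually_independent P G -> uniq s -> (forall i, i \in s -> G i (A i)) ->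
  P (\bigcap_(i in [set` s]) A i) = (\prod_(i <- s) P (A i))%E.
Proof.
move=> indep us GA.
have es : perm_eq [fset x in s]%fset s.
  by apply: uniq_perm => //= x; rewrite !inE.
rewrite -(perm_big _ es)/= -indep => [|i]; last by rewrite !inE => /GA.
by congr (P _); apply/seteqP; split=> w Aw x /= xs; apply: Aw; rewrite /= !inE in xs *.
Qed.

(** The definition quantifies over finite sets of indices, so an event indexed
    by [i] has to be found from the events indexed by the preimage of [i]; the
    intersection over this fibre, which has at most one element, does it. *)
Lemma mutually_independent_comp (R : realType) (d : measure_display)
  (T : measurableType d) (P : probability T R) (I K : choiceType)
  (G : I -> set (set T)) (h : K -> I) :
  injective h -> mutually_independent P G -> mutually_independent P (G \o h).
Proof.
move=> hI indep J A GA.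
pose A' i := \bigcap_(j in [set j | h j = i]) A j.
have A'h j : A' (h j) = A j.
  by apply/seteqP; split=> [w /(_ _ erefl)//|w Aw k /hI ->].
have := @mutually_independent_seq _ _ _ P _ G (map h J) A' indep.
rewrite map_inj_uniq// fset_uniq big_map => /(_ isT).
under eq_bigr do rewrite A'h.
move=> <-; last by move=> i /mapP[j jJ ->]; rewrite A'h; exact: GA.
congr (P _); apply/seteqP; split=> w /= Aw.
  by move=> i /= /mapP[j jJ ->]; rewrite A'h; exact: Aw.
by move=> j /= jJ; rewrite -A'h; apply: Aw; rewrite /= map_f.
Qed.

(** Independence is only given for events. The factors are replaced by
    indicators one after the other: the statement for a mixed product of
    indicators and functions follows, by [eq_integral_weight], from the statement
    in which one more function has been turned into an indicator. *)
Lemma integral_prod_indep (R : realType) (d : measure_display)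
  (T : measurableType d) (P : probability T R) (I : choiceType)
  (G : I -> set (set T)) (F : I -> T -> R) (c : I -> R) (s : seq I) :
  mutually_independent P G -> (forall i, G i `<=` measurable) ->
  (forall i w, 0 <= F i w) ->
  (forall i B, measurable B -> G i (F i @^-1` B)) ->
  (forall i, i \in s -> \int[P]_w (F i w)%:E = (c i)%:E)%E -> uniq s ->
  (\int[P]_w (\prod_(i <- s) F i w)%:E = (\prod_(i <- s) c i)%:E)%E.
Proof.
move=> indep Gm F0 GF Fc us.
have mF i : measurable_fun setT (F i).
  by move=> _ B mB; rewrite setTI; exact/Gm/GF.
have c0 i : i \in s -> 0 <= c i.
  by move=> /Fc; rewrite -lee_fin => <-; apply: integral_ge0 => w _; rewrite lee_fin.
suff main : forall s2 s1 (A : I -> set T), {subset s2 <= s} -> uniq (s1 ++ s2) ->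
    (forall i, i \in s1 -> G i (A i)) ->
    (\int[P]_w ((\prod_(i <- s1) \1_(A i) w) * \prod_(i <- s2) F i w)%:E =
     ((\prod_(i <- s1) fine (P (A i))) * \prod_(i <- s2) c i)%:E)%E.
  have := main s [::] (fun=> set0) (fun _ => id) us (fun _ => ltac:(by [])).
  rewrite big_nil mul1r => <-.
  by apply: eq_integral => w _; rewrite big_nil mul1r.
elim=> [|i s2 IH] s1 A s2s uss GA.
  rewrite cats0 in uss; rewrite big_nil mulr1.
  have -> : ((\prod_(i <- s1) fine (P (A i)))%:E =
      P (\bigcap_(i in [set` s1]) A i))%E.
    rewrite (mutually_independent_seq indep uss GA).
    rewrite (big_morph EFin EFinM erefl) !big_seq; apply: eq_bigr => j /GA/Gm mA.
    by rewrite fineK// fin_num_measure.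
  transitivity (\int[P]_w (\1_(\bigcap_(i in [set` s1]) A i) w)%:E)%E.
    apply: eq_integral => w _; congr _%:E; rewrite big_nil mulr1.
    elim: s1 {uss GA} => [|j s1 IHs].
      by rewrite big_nil set_nil bigcap_set0 indicE in_setT.
    rewrite big_cons IHs (_ : [set` j :: s1] = j |` [set` s1]).
      by rewrite bigcap_setU1 indicI.
    by apply/seteqP; split=> k /=; rewrite inE => /predU1P.
  rewrite integral_indic ?setIT//.
  by apply: fin_bigcap_measurable => [|j /GA/Gm//]; exact: finite_seq.
pose H w : R := (\prod_(i <- s1) \1_(A i) w) * \prod_(i <- s2) F i w.
pose a : R := (\prod_(i <- s1) fine (P (A i))) * \prod_(i <- s2) c i.
have uss' : uniq ((i :: s1) ++ s2).
  by move: uss; rewrite -(cat1s i s2) uniq_catCA.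
have mA j : j \in s1 -> measurable (A j) by move=> /GA/Gm.
have H0 w : 0 <= H w.
  by rewrite mulr_ge0// prodr_ge0// => j _; rewrite indicE.
have s2s' : {subset s2 <= s} by move=> j js2; apply: s2s; rewrite inE js2 orbT.
have is_s : i \in s by apply: s2s; rewrite inE eqxx.
have a0 : 0 <= a.
  apply: mulr_ge0; first by apply: prodr_ge0 => j _; exact: fine_ge0.
  by rewrite big_seq; apply: prodr_ge0 => j /s2s'; exact: c0.
have mH : measurable_fun setT H.
  apply: measurable_funM; last exact: measurable_prod.
  by apply: measurable_prod => j /mA mAj; exact: measurable_indic.
transitivity (\int[P]_w (F i w * H w)%:E)%E.
  by apply: eq_integral => w _; rewrite /H big_cons mulrCA.
rewrite (@eq_integral_weight _ _ _ _ (F i) H (cst a))//; last first.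
  move=> B mB; pose A' j := if j == i then F i @^-1` B else A j.
  have is1 : i \notin s1 by move: uss' => /= /andP[]; rewrite mem_cat negb_or => /andP[].
  have A's1 j : j \in s1 -> A' j = A j.
    by rewrite /A'; case: eqVneq => // ->; rewrite (negbTE is1).
  have A'i : A' i = F i @^-1` B by rewrite /A' eqxx.
  transitivity (\int[P]_w ((\prod_(j <- i :: s1) \1_(A' j) w) *
      \prod_(j <- s2) F j w)%:E)%E.
    apply: eq_integral => w _; rewrite big_cons A'i /H -mulrA; congr (_ * (_ * _))%:E.
    by rewrite !big_seq; apply: eq_bigr => j /A's1 ->.
  rewrite IH//; last first.
    by move=> j; rewrite inE => /predU1P[->|js1];
      [rewrite A'i; exact: GF|rewrite A's1//; exact: GA].
  have mFB : measurable (F i @^-1` B) by exact/Gm/GF.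
  under eq_integral do rewrite /= EFinM muleC.
  rewrite ge0_integralZl//; last first.
    by apply/measurable_EFinP; exact: measurable_indic.
  rewrite integral_indic// setIT big_cons A'i /a !EFinM.
  rewrite fineK ?fin_num_measure// -muleA muleC -EFinM; congr (_ * P _)%E.
  by congr (_ * _)%:E; rewrite !big_seq; apply: eq_bigr => j /A's1 ->.
under eq_integral do rewrite /= EFinM muleC.
rewrite ge0_integralZl//; last by move=> w _; rewrite lee_fin.
  by rewrite (Fc _ is_s) -EFinM big_cons /a; congr _%:E; ring.
exact/measurable_EFinP.
Qed.

Lemma measurable_superlevel (R : realType) (d : measure_display)
  (T : measurableType d) (f : T -> R) (x : R) :
  measurable_fun setT f -> measurable [set w | x <= f w].
Proof.
move=> mf; rewrite (_ : mkset _ = setT `&` f @^-1` `[x, +oo[); first exact: mf.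
by rewrite setTI; apply/seteqP; split=> w /=; rewrite in_itv/= andbT.
Qed.

Lemma sigma_of_comp (R : realType) (d : measure_display)
  (T : measurableType d) (X : T -> R) (f : R -> R) (B : set R) :
  measurable_fun setT f -> measurable B -> sigma_of X ((f \o X) @^-1` B).
Proof.
move=> mf mB; exists (f @^-1` B); last by rewrite setTI.
by rewrite -[X in measurable X]setTI; exact: mf.
Qed.

Lemma sigma_of_measurable (R : realType) (d : measure_display)
  (T : measurableType d) (X : T -> R) :
  measurable_fun setT X -> sigma_of X `<=` measurable.
Proof. by move=> mX _ [B mB <-]; exact: mX. Qed.

(** Exponential Markov inequality for a sum of functions of independent
    variables; [kappa i] bounds the logarithm of the moment generating function
    of the [i]-th summand. *)
Lemma chernoff (R : realType) (d : measure_display)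
  (T : measurableType d) (P : probability T R) (X : nat -> {RV P >-> R})
  (f : nat -> R -> R) (kappa : nat -> R) (s : seq nat) (x : R) :
  mutually_independent P (fun i => sigma_of (X i)) ->
  (forall i, measurable_fun setT (f i)) ->
  (forall i, i \in s ->
     \int[P]_w (expR (f i (X i w)))%:E <= (expR (kappa i))%:E)%E -> uniq s ->
  (P [set w | (x <= \sum_(i <- s) f i (X i w))%R] <=
   (expR (\sum_(i <- s) kappa i - x))%:E)%E.
Proof.
move=> indep mf fk us.
pose F i w := expR (f i (X i w)).
have F0 i w : 0 <= F i w by exact: expR_ge0.
have mX i : measurable_fun setT (X i) by exact: measurable_funP.
have mfX i : measurable_fun setT (fun w => f i (X i w)) by exact: measurableT_comp.
have GF i B : measurable B -> sigma_of (X i) (F i @^-1` B).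
  apply: (@sigma_of_comp _ _ _ (X i) (expR \o f i)).
  by apply: measurableT_comp.
have Gm i : sigma_of (X i) `<=` measurable by exact: sigma_of_measurable.
have ci i : i \in s -> (\int[P]_w (F i w)%:E = (fine (\int[P]_w (F i w)%:E))%:E)%E.
  move=> /fk h; have I0 : (0 <= \int[P]_w (F i w)%:E)%E.
    by apply: integral_ge0 => w _; rewrite lee_fin.
  by rewrite fineK// ge0_fin_numE//; apply: le_lt_trans h (ltry _).
have msum : measurable_fun setT (fun w => \sum_(i <- s) f i (X i w)).
  exact: measurable_sum.
have mS : measurable [set w | (x <= \sum_(i <- s) f i (X i w))%R].
  exact: measurable_superlevel.
have mexp : measurable_fun setT (fun w => \prod_(i <- s) F i w).
  by apply: measurable_prod => i _; apply: measurableT_comp.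
have x0 : 0 <= expR (- x) :> R by exact: expR_ge0.
have -> : P [set w | (x <= \sum_(i <- s) f i (X i w))%R] =
    (\int[P]_w (\1_[set w | (x <= \sum_(i <- s) f i (X i w))%R] w)%:E)%E.
  by rewrite integral_indic// setIT.
apply: (@le_trans _ _ (\int[P]_w ((expR (- x))%:E * (\prod_(i <- s) F i w)%:E))%E).
  apply: ge0_le_integral => //.
  - by apply/measurable_EFinP; exact: measurable_indic.
  - by apply: measurable_funeM; exact/measurable_EFinP.
  - move=> w _; rewrite -EFinM lee_fin indicE -expR_sum -expRD.
    case: (boolP (w \in _)) => [|_]; last exact: expR_ge0.
    by rewrite inE/= => h; rewrite -expR0 ler_expR; lra.
rewrite ge0_integralZl//; last 2 first.
- exact/measurable_EFinP.
- by move=> w _; rewrite lee_fin prodr_ge0.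
rewrite (integral_prod_indep indep Gm F0 GF ci us) -EFinM lee_fin.
rewrite expRD mulrC expR_sum; apply: ler_wpM2r => //.
rewrite !big_seq; apply: ler_prod => i is_.
rewrite -!lee_fin -ci// fk// andbT.
by apply: integral_ge0 => w _; rewrite lee_fin.
Qed.

(** * Uniform and sub-Gaussian variables *)

Lemma measurable_preimage_RV (R : realType) (d : measure_display)
  (T : measurableType d) (P : probability T R) (X : {RV P >-> R}) (A : set R) :
  measurable A -> measurable (X @^-1` A).
Proof. by move=> mA; rewrite -[X in measurable X]setTI; exact: measurable_funP. Qed.

Lemma uniform01_lebesgue (R : realType) (d : measure_display)
  (T : measurableType d) (P : probability T R) (X : {RV P >-> R}) (A : set R) :
  uniform01 X -> measurable A ->
  P (X @^-1` A) = lebesgue_measure (A `&` `[0, 1]).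
Proof.
move=> unifX mA; transitivity (distribution P X A); first by [].
rewrite (unifX A mA).
rewrite /uniform_prob integral_uniform_pdf.
rewrite (eq_integral (fun=> 1%E)); last first.
  move=> y; rewrite inE => -[_ /=]; rewrite in_itv/=.
  by rewrite /uniform_pdf => ->; rewrite subr0 invr1.
by rewrite integral_cst ?mul1e//; exact: measurableI.
Qed.

Lemma uniform01_itvco (R : realType) (d : measure_display)
  (T : measurableType d) (P : probability T R) (X : {RV P >-> R}) (a b : R) :
  uniform01 X -> 0 <= a -> a <= b -> b <= 1 ->
  P (X @^-1` `[a, b[) = (b - a)%:E.
Proof.
move=> unifX a0 ab b1; rewrite uniform01_lebesgue//.
rewrite setIidl; last first.
  move=> y /=; rewrite !in_itv/= => /andP[ay yb].
  by rewrite (le_trans a0)//= (le_trans (ltW yb)).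
rewrite lebesgue_measure_itv/= lte_fin; case: ltP => // ba.
by rewrite (_ : b = a) ?subrr//; apply/eqP; rewrite eq_le ba.
Qed.

Lemma uniform01_le (R : realType) (d : measure_display)
  (T : measurableType d) (P : probability T R) (X : {RV P >-> R}) (q : R) :
  uniform01 X -> 0 <= q -> q <= 1 -> P (X @^-1` `]-oo, q]) = q%:E.
Proof.
move=> unifX q0 q1; rewrite uniform01_lebesgue//.
rewrite (_ : _ `&` _ = `[0, q]%classic).
  rewrite lebesgue_measure_itv/= lte_fin; case: ltP => [_|qle].
    by rewrite -EFinB subr0.
  by rewrite (_ : q = 0)//; apply/eqP; rewrite eq_le q0 qle.
apply/seteqP; split=> y /=; rewrite !in_itv/=; first by move=> [-> /andP[->]].
by move=> /andP[-> yq]; rewrite yq (le_trans yq).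
Qed.

Lemma uniform01_gt (R : realType) (d : measure_display)
  (T : measurableType d) (P : probability T R) (X : {RV P >-> R}) (q : R) :
  uniform01 X -> 0 <= q -> q <= 1 -> P (X @^-1` `]q, +oo[) = (1 - q)%:E.
Proof.
move=> unifX q0 q1.
have mq : measurable (X @^-1` `]-oo, q]) by exact: measurable_preimage_RV.
rewrite (_ : _ @^-1` _ = ~` (X @^-1` `]-oo, q])); last first.
  by apply/seteqP; split=> w /=; rewrite !in_itv/= andbT ltNge => /negP.
by rewrite probability_setC// (uniform01_le unifX).
Qed.

Lemma uniform01_ae (R : realType) (d : measure_display)
  (T : measurableType d) (P : probability T R) (X : {RV P >-> R}) :
  uniform01 X -> {ae P, forall w, 0 < X w <= 1}.
Proof.
move=> unifX; exists (X @^-1` `]-oo, 0] `|` X @^-1` `]1, +oo[); split.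
- by apply: measurableU; exact: measurable_preimage_RV.
- have P0 := uniform01_le unifX (lexx 0) ler01.
  have P1 := uniform01_gt unifX ler01 (lexx 1).
  rewrite subrr in P1.
  by rewrite (measureU0 _ _ P1)//; exact: measurable_preimage_RV.
- move=> w /= /negP; rewrite !in_itv/= andbT negb_and -leNgt -ltNge.
  by move=> /orP[]; [left|right].
Qed.

(** The moment generating functions below are estimated through such
    combinations of indicators, whose integrals are explicit. *)
Lemma integral_indic_comb (R : realType) (d : measure_display)
  (T : measurableType d) (P : probability T R) (n : nat) (c0 : R)
  (c q : nat -> R) (A : nat -> set T) :
  0 <= c0 -> (forall j, 0 <= c j) -> (forall j, measurable (A j)) ->
  (forall j, (j < n)%N -> P (A j) = (q j)%:E) ->
  (\int[P]_w (c0 + \sum_(j < n) c j * \1_(A j) w)%:E =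
   (c0 + \sum_(j < n) c j * q j)%:E)%E.
Proof.
move=> c00 cj0 mA PA.
have mI j : measurable_fun setT (\1_(A j) : T -> R) by exact: measurable_indic.
have mcI j : measurable_fun setT (fun w => (c j * \1_(A j) w)%:E).
  by apply/measurable_EFinP; exact: measurable_funM.
under eq_integral do rewrite EFinD -sumEFin.
rewrite ge0_integralD//; last 2 first.
- by move=> w _; apply: sume_ge0 => j _; rewrite lee_fin mulr_ge0.
- by apply: emeasurable_sum.
rewrite integral_cst//.
rewrite [X in (_ * X + _)%E](probability_setT P) mule1 EFinD; congr (_ + _)%E.
rewrite ge0_integral_sum//; last by move=> j w _; rewrite lee_fin mulr_ge0.
rewrite -sumEFin; apply: eq_bigr => j _.
under eq_integral do rewrite EFinM.
have mE : measurable_fun setT (fun w => (\1_(A j) w : R)%:E) by exact/measurable_EFinP.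
rewrite ge0_integralZl// ?lee_fin//.
by rewrite integral_indic// setIT EFinM; congr (_ * _)%E; exact: PA.
Qed.

(** The exponent y / zeta^2, where y is the half-width of the confidence
    interval, minimizes the bound given by the exponential Markov inequality.
    The sign [sgn] makes one lemma serve both tails. *)
Lemma subgaussian_sum_tail (R : realType) (d : measure_display)
  (T : measurableType d) (P : probability T R) (zeta b : R)
  (X : nat -> {RV P >-> R}) (n : nat) (sgn : R) :
  0 < zeta -> 0 < b -> (0 < n)%N -> sgn ^+ 2 = 1 ->
  mutually_independent P (fun i => sigma_of (X i)) ->
  (forall i, subgaussian zeta (X i)) ->
  (P [set w | (n%:R * Num.sqrt (zeta ^+ 2 * b / n%:R) <=
               \sum_(0 <= i < n) sgn * X i w)%R] <= (expR (- (b / 2)))%:E)%E.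
Proof.
move=> zeta0 b0 n0 sgn1 indep subg.
have nR : 0 < n%:R :> R by rewrite ltr0n.
pose y := Num.sqrt (zeta ^+ 2 * b / n%:R).
have y2 : y ^+ 2 * n%:R = zeta ^+ 2 * b.
  by rewrite sqr_sqrtr ?divfK ?gt_eqF// ltW// divr_gt0// mulr_gt0// exprn_gt0.
have y0 : 0 < y by rewrite sqrtr_gt0 divr_gt0// mulr_gt0// exprn_gt0.
pose th := y / zeta ^+ 2.
have th0 : 0 < th by rewrite divr_gt0// exprn_gt0.
pose f (i : nat) (z : R) := th * (sgn * z).
have mf i : measurable_fun setT (f i).
  by apply: measurable_funM => //; apply: measurable_funM.
pose kappa (i : nat) := zeta ^+ 2 * th ^+ 2 / 2.
have fk i : i \in index_iota 0 n ->
    (\int[P]_w (expR (f i (X i w)))%:E <= (expR (kappa i))%:E)%E.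
  move=> _; have := subg i (th * sgn); rewrite unlock exprMn sgn1 mulr1.
  apply: le_trans; rewrite le_eqVlt; apply/orP; left; apply/eqP.
  by apply: eq_integral => w _; rewrite /f mulrA.
have := @chernoff _ _ _ P X f kappa (index_iota 0 n) (th * (n%:R * y)) indep mf fk.
move=> /(_ (iota_uniq _ _)).
have -> : [set w | th * (n%:R * y) <= \sum_(i <- index_iota 0 n) f i (X i w)] =
    [set w | n%:R * y <= \sum_(0 <= i < n) sgn * X i w].
  have e w : \sum_(i <- index_iota 0 n) f i (X i w) =
      th * \sum_(0 <= i < n) sgn * X i w by rewrite mulr_sumr.
  by apply/seteqP; split=> w /=; rewrite e ler_pM2l.
rewrite -/y => /le_trans; apply; rewrite lee_fin ler_expR.
have -> : th * (n%:R * y) = b.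
  rewrite /th (_ : _ * _ = y ^+ 2 * n%:R / zeta ^+ 2); last by ring.
  by rewrite y2 mulrC mulKf// gt_eqF// exprn_gt0.
have -> : \sum_(i <- index_iota 0 n) kappa i = b / 2.
  rewrite /kappa sumr_const_nat subn0 -(mulr_natr (zeta ^+ 2 * th ^+ 2 / 2)).
  rewrite (_ : _ * n%:R = (y ^+ 2 * n%:R) / zeta ^+ 2 / 2).
    by rewrite y2 [zeta ^+ 2 * b]mulrC mulfK// gt_eqF// exprn_gt0.
  by rewrite /th; move: (n%:R : R) => m; field; rewrite gt_eqF.
lra.
Qed.

(** * Counting pulls and using confidence bounds *)

Lemma npullsS (p : nat -> nat) (a t : nat) :
  npulls p a t.+1 = (npulls p a t + (p t.+1 == a))%N.
Proof. by rewrite /npulls big_nat_recr. Qed.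

Lemma npulls0 (p : nat -> nat) (a : nat) : npulls p a 0 = 0%N.
Proof. by rewrite /npulls big_geq. Qed.

Lemma leq_npulls (p : nat -> nat) (a t t' : nat) :
  (t <= t')%N -> (npulls p a t <= npulls p a t')%N.
Proof.
elim: t' => [|t' IH]; first by rewrite leqn0 => /eqP ->.
by rewrite leq_eqVlt => /predU1P[->//|/IH h]; rewrite npullsS (leq_trans h)// leq_addr.
Qed.

Lemma npulls_le (p : nat -> nat) (a t : nat) : (npulls p a t <= t)%N.
Proof.
elim: t => [|t IH]; first by rewrite npulls0.
by rewrite npullsS -addn1 leq_add// leq_b1.
Qed.

Lemma npulls_gt0 (p : nat -> nat) (a t : nat) :
  (forall s, (0 < s)%N -> (1 <= p s <= s)%N) ->
  (0 < npulls p a t)%N -> (1 <= a <= t)%N.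
Proof.
move=> pP; elim: t => [|t IH]; first by rewrite npulls0.
rewrite npullsS; case: eqP => [<- _|_]; first exact: pP.
by rewrite addn0 => /IH/andP[-> /leqW].
Qed.

(** Just before the last time in [Q] at which [a] is pulled, it had been pulled
    at all the earlier ones. *)
Lemma sum_pulls_le (R : realType) (p : nat -> nat) (Q : pred nat) (a t : nat)
  (B : R) : 0 <= B ->
  (forall s, (0 < s <= t)%N -> Q s -> p s = a -> (npulls p a s.-1)%:R <= B) ->
  (\sum_(1 <= s < t.+1) (Q s && (p s == a)))%:R <= 1 + B.
Proof.
move=> B0; elim: t => [|t IH] hB; first by rewrite big_geq// addr_ge0.
rewrite big_nat_recr//=; case: (boolP (Q t.+1 && _)) => [/andP[Qt /eqP pt]|_].
  rewrite addn1 -natr1 addrC lerD2l.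
  apply: le_trans (hB t.+1 _ Qt pt); last by rewrite ltnS leqnn.
  rewrite ler_nat /npulls leq_sum// => s _.
  by case: (Q s).
by rewrite addn0; apply: IH => s /andP[s0 st]; apply: hB; rewrite s0 leqW.
Qed.

Lemma sum_window_le (R : realType) (p : nat -> nat) (Q : pred nat) (K t : nat)
  (B : nat -> R) : (forall a, 0 <= B a) ->
  (forall s, (0 < s <= t)%N -> Q s -> (1 <= p s < K)%N) ->
  (forall a s, (0 < s <= t)%N -> Q s -> p s = a ->
     (npulls p a s.-1)%:R <= B a) ->
  (\sum_(1 <= s < t.+1) Q s)%:R <= \sum_(1 <= a < K) (1 + B a).
Proof.
move=> B0 pK hB.
have -> : (\sum_(1 <= s < t.+1) Q s =
    \sum_(1 <= a < K) \sum_(1 <= s < t.+1) (Q s && (p s == a)))%N.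
  rewrite exchange_big/=; apply: eq_big_nat => s /andP[s0 st].
  case: (boolP (Q s)) => Qs /=; last by rewrite big1.
  have /andP[p1 pK'] := pK s ltac:(by rewrite s0) Qs.
  rewrite (bigD1_seq (p s)) ?iota_uniq ?mem_index_iota ?p1//= eqxx.
  by rewrite big1 ?addn0// => a; rewrite eq_sym => /negbTE ->.
rewrite natr_sum; apply: ler_sum => a _; apply: sum_pulls_le => // s st Qs.
exact: hB.
Qed.

Section Confidence.
Variables (R : realType) (zeta : R) (beta : nat -> R).
Variables (x : nat -> nat -> R) (mu : nat -> R) (p : nat -> nat).
Hypothesis conc : forall a t, (0 < npulls p a t)%N ->
  `|emp_mean x p a t - mu a| <= width zeta beta p a t.

Lemma UCB_ge_mean a t : ((mu a)%:E <= UCB zeta beta x p a t)%E.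
Proof.
rewrite /UCB; case: eqP => [|/eqP]; first by rewrite leey.
by rewrite -lt0n => /conc; rewrite lee_fin ler_distlC => /andP[_].
Qed.

Lemma LCB_le_mean a t : (LCB zeta beta x p a t <= (mu a)%:E)%E.
Proof.
rewrite /LCB; case: eqP => [|/eqP]; first by rewrite leNye.
by rewrite -lt0n => /conc; rewrite lee_fin ler_distlC => /andP[].
Qed.

(** The upper bound of [a] exceeds that of [b], hence the mean of [b]. *)
Lemma optimism (D : set nat) a b t : (0 < npulls p a t)%N -> D b ->
  is_argmax D (fun c => UCB zeta beta x p c t) a ->
  mu b <= mu a + 2 * width zeta beta p a t.
Proof.
move=> na Db [_ /(_ b Db)] /(le_trans (UCB_ge_mean b t)).
rewrite /UCB gtn_eqF// lee_fin => /le_trans; apply.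
by have := conc na; rewrite ler_distl => /andP[_]; lra.
Qed.

(** The lower bound of the recommended arm is below its mean and above the
    lower bound of any other arm. *)
Lemma pessimism (D : set nat) a b t : (0 < npulls p a t)%N -> D a ->
  is_argmax D (fun c => LCB zeta beta x p c t) b ->
  mu a - 2 * width zeta beta p a t <= mu b.
Proof.
move=> na Da [_ /(_ a Da)] /le_trans /(_ (LCB_le_mean b t)).
rewrite /LCB gtn_eqF// lee_fin; apply: le_trans.
by have := conc na; rewrite ler_distl => /andP[]; lra.
Qed.

Lemma width_le (b : R) (n a t : nat) :
  (0 < n <= npulls p a t)%N -> zeta ^+ 2 * beta t <= b -> 0 <= b ->
  width zeta beta p a t <= Num.sqrt (b / n%:R).
Proof.
move=> /andP[n0 nN] hb b0; have N0 := leq_trans n0 nN.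
apply: ler_wsqrtr; apply: (@le_trans _ _ (b / (npulls p a t)%:R)).
  by rewrite ler_wpM2r// invr_ge0.
by rewrite ler_wpM2l// lef_pV2 ?posrE ?ltr0n// ler_nat.
Qed.
End Confidence.

(** * Dyadic scales and scopes *)

Lemma expR_le_inv (R : realType) (y : R) : y < 1 -> expR y <= (1 - y)^-1.
Proof.
move=> y1; rewrite -[leLHS]invrK lef_pV2 ?posrE ?invr_gt0 ?expR_gt0 ?subr_gt0//.
by rewrite -expRN; exact: expR_ge1Dx.
Qed.

Lemma expR_half_le2 (R : realType) : expR (2^-1) <= 2 :> R.
Proof.
apply: le_trans (expR_le_inv _) _; first by lra.
by rewrite (_ : 1 - 2^-1 = 2^-1 :> R) ?invrK//; lra.
Qed.

Lemma expR1_le4 (R : realType) : expR 1 <= 4 :> R.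
Proof.
have h := expR_half_le2 R.
rewrite (_ : 1 = 2^-1 + 2^-1 :> R); last by lra.
rewrite expRD; apply: le_trans (ler_pM _ _ h h) _; rewrite ?expR_ge0//; lra.
Qed.

Lemma ln2_ge_half (R : realType) : 2^-1 <= ln 2 :> R.
Proof.
rewrite -[leLHS]expRK ler_ln ?posrE ?expR_gt0//.
exact: expR_half_le2.
Qed.

(** A combination of indicators of [g <= 2^-j] that dominates
    2^-J / max (g, 2^-J), see [rank_weight_ge]. Only the probabilities of these
    dyadic events are then needed to estimate its moments. *)
Definition rank_weight (R : realType) (J : nat) (g : R) : R :=
  (\sum_(j < J.+1) 2 ^+ j.+1 * (g <= 2 ^- j)%R%:R) / 2 ^+ J.

Lemma rank_weight_ge0 (R : realType) (J : nat) (g : R) : 0 <= rank_weight J g.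
Proof.
by rewrite divr_ge0 ?exprn_ge0// sumr_ge0// => j _; rewrite mulr_ge0 ?exprn_ge0.
Qed.

(** The largest [j <= J] with [g <= 2^-j] contributes a single term that is
    already large enough. *)
Lemma rank_weight_ge (R : realType) (J : nat) (g nu : R) :
  g <= 1 -> g <= nu -> 2 ^- J <= nu -> 2 ^- J / nu <= rank_weight J g.
Proof.
move=> g1 gnu Jnu.
have nu0 : 0 < nu by apply: lt_le_trans Jnu; rewrite invr_gt0 exprn_gt0.
rewrite mulrC /rank_weight ler_pM2r ?invr_gt0 ?exprn_gt0//.
have term0 j : 0 <= 2 ^+ j.+1 * (g <= 2 ^- j)%R%:R :> R.
  by rewrite mulr_ge0 ?exprn_ge0.
rewrite -[leLHS]mul1r ler_pdivrMr//.
elim: J Jnu => [|J IH] Jnu; rewrite big_ord_recr/=.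
  rewrite expr0 invr1 in Jnu.
  by rewrite big_ord0 add0r expr0 invr1 g1 mulr1 expr1; lra.
have [gJ|gJ] := leP g (2 ^- J.+1).
  rewrite mulr1 mulrDl -[leLHS]add0r lerD//.
    by rewrite mulr_ge0 ?sumr_ge0// ltW.
  have : 1 <= 2 ^+ J.+1 * nu by rewrite -ler_pdivrMl ?exprn_gt0// mulr1.
  by rewrite (exprS 2 J.+1) -mulrA; lra.
rewrite mulr0 addr0.
have [gJ'|gJ'] := leP g (2 ^- J); last by apply: IH; exact: ltW (lt_le_trans gJ' gnu).
rewrite big_ord_recr/= gJ' mulr1 mulrDl -[leLHS]add0r lerD//.
  by rewrite mulr_ge0 ?sumr_ge0// ltW.
rewrite -ler_pdivrMl ?exprn_gt0// mulr1; exact: le_trans (ltW gJ) gnu.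
Qed.

Lemma dyadic_scale (R : realType) (rho : R) : 0 < rho -> rho < 1 ->
  exists J : nat, 2 ^- J <= rho /\ rho < 2 * 2 ^- J.
Proof.
move=> r0 r1.
have ex : exists n, rho^-1 <= 2 ^+ n.
  exists (Num.truncn rho^-1).+1; apply: (@le_trans _ _ (Num.truncn rho^-1).+1%:R).
    by apply: ltW; rewrite truncnS_gt.
  by rewrite -natrX ler_nat ltnW// ltn_expl.
case: (ex_minnP ex) => [[|n]] hn hmin.
  by move: hn; rewrite expr0 invf_le1// leNgt r1.
exists n.+1; split.
  by rewrite -[leRHS]invrK lef_pV2 ?posrE ?invr_gt0 ?exprn_gt0.
have : 2 ^+ n < rho^-1 by rewrite ltNge; apply/negP => /hmin; rewrite ltnn.
rewrite exprS invfM mulrA divff// mul1r => h.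
by rewrite -[ltLHS]invrK ltf_pV2 ?posrE ?invr_gt0 ?exprn_gt0.
Qed.

Lemma le_sqrt_div (R : realType) (n : nat) (c D b : R) : (0 < n)%N -> 0 <= b ->
  0 <= c -> 0 <= D -> D <= c * Num.sqrt (b / n%:R) -> n%:R * D ^+ 2 <= c ^+ 2 * b.
Proof.
move=> n0 b0 c0 D0 hD; have n0' : 0 < n%:R :> R by rewrite ltr0n.
have -> : c ^+ 2 * b = n%:R * (c * Num.sqrt (b / n%:R)) ^+ 2.
  rewrite exprMn sqr_sqrtr; last by rewrite divr_ge0// ltW.
  by move: n0'; move: (n%:R : R) => m m0; field; rewrite gt_eqF.
by rewrite ler_wpM2l ?ler_sqr ?nnegrE// ?mulr_ge0// ltW.
Qed.

(** The infimum that defines [sample_cost] need not be attained; the factor 2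
    pays for this. *)
Lemma reachable_benchmark (R : realType) (zeta : R) (lambda : R -> R)
  (psi : R) (t : nat) (eta : R) : 0 < psi -> (0 < t)%N ->
  reachable zeta lambda psi t eta ->
  exists rho, [/\ 0 < rho, rho < eta, rho^-1 <= 2 * (t%:R / psi) &
    forall nu, eta <= nu <= 1 -> lambda rho != lambda nu /\
      zeta ^+ 2 * nu / (rho * (lambda rho - lambda nu) ^+ 2)
        <= 2 * (t%:R / psi)].
Proof.
move=> psi0 t0 [/andP[eta0 eta1] hS].
have tp : 0 < t%:R / psi by rewrite divr_gt0// ltr0n.
have : (sample_cost zeta lambda eta < (2 * (t%:R / psi))%:E)%E.
  by apply: le_lt_trans hS _; rewrite lte_fin; lra.
move=> /ereal_inf_lt[_ [rho /= rI <-] hsup].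
move: rI; rewrite in_itv/= => /andP[r0 re].
have gap nu : eta <= nu <= 1 ->
    (gap_cost zeta lambda rho nu <= (2 * (t%:R / psi))%:E)%E.
  move=> nuI; apply: le_trans (ltW hsup); apply: ereal_sup_ubound.
  by exists nu => //=; rewrite in_itv.
exists rho; split => //.
  have := gap eta; rewrite lexx (ltW eta1) => /(_ isT).
  by rewrite /gap_cost; case: ifP => // _; rewrite lee_fin ge_max => /andP[].
move=> nu /gap; rewrite /gap_cost; case: ifPn => // h.
by rewrite lee_fin ge_max => /andP[].
Qed.

(** The scope s^(u s) falls in a prescribed range exactly when [u s] falls in
    an interval whose length, for the range [k, 2 k), is ln 2 / ln s. *)
Lemma scope_window (R : realType) (u : nat -> R) (k s : nat) :
  (0 < k)%N -> (2 * k <= s)%N ->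
  u s \in `[ln k%:R / ln s%:R, ln (2 * k)%:R / ln s%:R[ ->
  (k <= scope u s < 2 * k)%N.
Proof.
move=> k0 ks; rewrite in_itv/= => /andP[h1 h2].
have s1 : (1 < s)%N by lia.
have s0 : 0 < s%:R :> R by rewrite ltr0n; lia.
have ls : 0 < ln (s%:R : R) by rewrite ln_gt0// ltr1n.
have kE : k%:R <= s%:R `^ u s.
  rewrite -[leLHS]lnK ?posrE ?ltr0n// /powR gt_eqF// ler_expR.
  by rewrite -ler_pdivrMr.
have k2E : s%:R `^ u s < (2 * k)%:R.
  rewrite -[ltRHS]lnK ?posrE ?ltr0n ?muln_gt0// /powR gt_eqF// ltr_expR.
  by rewrite -ltr_pdivlMr.
have p0 : 0 <= s%:R `^ u s by exact: powR_ge0.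
rewrite /scope; apply/andP; split; first by rewrite truncn_ge_nat.
by rewrite truncn_lt_nat.
Qed.

Lemma scope_le (R : realType) (u : nat -> R) (s : nat) :
  (0 < s)%N -> u s <= 1 -> (scope u s <= s)%N.
Proof.
move=> s0 u1; rewrite /scope -(ler_nat R); apply: (@le_trans _ _ (s%:R `^ u s)).
  by rewrite truncn_le// powR_ge0.
by rewrite -[leRHS]powRr1// ler_powR// ler1n.
Qed.

(** * The deterministic argument *)

(** With this many arms, all ranks exceed 2^-J with probability at most
    exp (- 3 l). *)
Definition num_arms (R : realType) (l : R) (J : nat) : nat :=
  (Num.truncn (3 * l * 2 ^+ J)).+1.

(** The draws for which the scope lies in [k, 2 k), see [scope_window]. *)
Definition window (R : realType) (k s : nat) : interval R :=
  `[ln k%:R / ln s%:R, ln (2 * k)%:R / ln s%:R[.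

Definition good_scale (R : realType) (l : R) (J t : nat) (g u : nat -> R) :=
  let k := num_arms l J in
  [/\ exists2 a, (1 <= a <= k)%N & g a <= 2 ^- J,
      \sum_(1 <= a < 2 * k) rank_weight J (g a) <= 32 * l * J.+1%:R + 24 * l
    & t%:R / (16 * l) <= \sum_(2 * k <= s < t.+1) (u s \in window R k s)%:R].

Lemma num_arms_ge (R : realType) (l : R) (J : nat) :
  3 * l * 2 ^+ J <= (num_arms l J)%:R.
Proof. by rewrite /num_arms ltW// truncnS_gt. Qed.

Lemma num_arms_le (R : realType) (l : R) (J : nat) : 1 <= l ->
  (num_arms l J)%:R <= 4 * l * 2 ^+ J.
Proof.
move=> l1; have p0 : 1 <= 2 ^+ J :> R by rewrite exprn_ege1// ler1n.
have h : 1 <= l * 2 ^+ J by rewrite -[leLHS]mulr1 ler_pM.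
rewrite /num_arms -natr1.
have : (Num.truncn (3 * l * 2 ^+ J))%:R <= 3 * l * 2 ^+ J.
  by rewrite truncn_le -mulrA; lra.
by rewrite -!mulrA in h *; lra.
Qed.

Section Run.
Variables (R : realType) (zeta : R) (lambda : R -> R) (l : nat -> R).
Variables (g u : nat -> R) (x : nat -> nat -> R) (p r : nat -> nat).
Hypothesis lambda_noninc : forall y z : R, 0 < y -> y <= z -> z <= 1 ->
  lambda z <= lambda y.
Hypothesis g_itv : forall a, (0 < a)%N -> 0 < g a <= 1.
Hypothesis run : OSE_path zeta (fun s => 6 * l s) x u p r.
Hypothesis conc : forall a s, (0 < npulls p a s)%N ->
  `|emp_mean x p a s - lambda (g a)| <= width zeta (fun s => 6 * l s) p a s.
Variable t : nat.
Hypothesis t_gt0 : (0 < t)%N.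
Hypothesis l_le : forall s, (0 < s <= t)%N -> l s <= l t.

(** Optimism puts the mean of the pulled arm at most 2 half-widths below
    [lambda rho]; pessimism at the final time costs 2 more half-widths for the
    recommended arm. Hence the constant 96 = 4^2 * 6. *)
Lemma pulls_gap (k b a s : nat) (rho nu : R) : 1 <= l t -> (0 < s <= t)%N ->
  (0 < npulls p a s.-1)%N -> p s = a -> (k <= scope u s)%N ->
  (1 <= b <= k)%N -> g b <= rho -> rho <= 1 ->
  nu = g a \/ nu = g (r t) -> lambda nu <= lambda rho ->
  (npulls p a s.-1)%:R * (lambda rho - lambda nu) ^+ 2 <= 96 * zeta ^+ 2 * l t.
Proof.
move=> l_ge1 /andP[s0 st] n0 psa ks /andP[b1 bk] gb r1 nuE Dge0.
set n := npulls p a s.-1 in n0 *.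
have s1 : (0 < s.-1)%N.
  by move: n0; rewrite /n; case: (s.-1) => //; rewrite npulls0.
have [pP _ _] := run s0.
have [_ _ rP] := run t_gt0.
have bE : 0 <= zeta ^+ 2 * (6 * l t).
  by rewrite mulr_ge0 ?sqr_ge0//; lra.
have aP : (1 <= a)%N by move: pP => [/=]; rewrite psa => /andP[].
have nt : (n <= npulls p a t)%N by apply: leq_npulls; lia.
have n0t : (0 < npulls p a t)%N by exact: leq_trans nt.
have hb : lambda rho <= lambda (g b).
  by apply: lambda_noninc => //; case/andP: (g_itv b1).
have w1 : width zeta (fun s => 6 * l s) p a s.-1 <=
    Num.sqrt (zeta ^+ 2 * (6 * l t) / n%:R).
  apply: width_le => //; first by rewrite n0 leqnn.
  rewrite ler_wpM2l ?sqr_ge0//; have := @l_le s.-1; rewrite s1 => /(_ ltac:(lia)).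
  by lra.
have w2 : width zeta (fun s => 6 * l s) p a t <=
    Num.sqrt (zeta ^+ 2 * (6 * l t) / n%:R).
  by apply: width_le => //; rewrite n0.
have o : lambda (g b) <= lambda (g a) + 2 * width zeta (fun s => 6 * l s) p a s.-1.
  apply: (optimism conc n0 _ (D := [set c | (1 <= c <= scope u s)%N])).
    by rewrite /= b1 (leq_trans bk).
  by rewrite -psa.
have q : lambda (g a) - 2 * width zeta (fun s => 6 * l s) p a t <= lambda (g (r t)).
  by apply: (pessimism conc n0t _ rP) => /=.
have sq0 := sqrtr_ge0 (zeta ^+ 2 * (6 * l t) / n%:R).
have : n%:R * (lambda rho - lambda nu) ^+ 2 <= 4 ^+ 2 * (zeta ^+ 2 * (6 * l t)).
  apply: le_sqrt_div => //; first by rewrite subr_ge0.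
  move: w1 w2 o q sq0.
  move: (width _ _ _ _ _) (width _ _ _ _ _) (Num.sqrt _) => y1 y2 y3.
  by case: nuE => ->; lra.
by lra.
Qed.

(** The gap cost turns the bound of [pulls_gap] into one that depends on the
    rank of the pulled arm only, and which is summable over the arms. *)
Lemma pulls_rank_weight (J k b a s : nat) (rho eta tau : R) :
  1 <= l t -> (0 < s <= t)%N ->
  p s = a -> (k <= scope u s)%N ->
  (1 <= b <= k)%N -> g b <= 2 ^- J -> 2 ^- J <= rho -> rho < 2 * 2 ^- J ->
  rho < eta -> eta < g (r t) -> 0 <= tau ->
  (forall nu, eta <= nu <= 1 -> lambda rho != lambda nu /\
      zeta ^+ 2 * nu / (rho * (lambda rho - lambda nu) ^+ 2) <= 2 * tau) ->
  (npulls p a s.-1)%:R <= 384 * l t * tau * rank_weight J (g a).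
Proof.
move=> l_ge1 sI psa ks bI gb Jr rJ re er tau0 gap.
have [->|n0] := posnP (npulls p a s.-1).
  apply: mulr_ge0; last exact: rank_weight_ge0.
  by apply: mulr_ge0; [lra|exact: tau0].
have [s0 _] := andP sI.
have [pP _ _] := run s0; have [_ _ [/= r1 _]] := run t_gt0.
have aP : (1 <= a)%N by move: pP => [/=]; rewrite psa => /andP[].
have /andP[ga0 ga1] := g_itv aP; have /andP[gr0 gr1] := g_itv r1.
have J0 : 0 < 2 ^- J :> R by rewrite invr_gt0 exprn_gt0.
(* An arm of rank below [eta] is charged with the gap of the recommended
   arm, any other arm with its own gap. *)
have [nu [nuE /andP[en n1] gan]] : exists nu, [/\ nu = g a \/ nu = g (r t),
    eta <= nu <= 1 & g a <= nu].
  have [ea|ae] := leP eta (g a).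
    by exists (g a); split; [left|rewrite ea|].
  by exists (g (r t)); split; [right|rewrite ltW|rewrite ltW// (lt_trans ae)].
have [lneq hG] := gap nu ltac:(by rewrite en).
have rho0 : 0 < rho by exact: lt_le_trans Jr.
have nu0 : 0 < nu by rewrite (lt_le_trans _ en)// (lt_trans rho0).
have rho1 : rho <= 1 by rewrite ltW// (lt_le_trans re)// (le_trans en).
have Jnu : 2 ^- J <= nu by rewrite (le_trans Jr)// (le_trans (ltW re)).
have Dge0 : lambda nu <= lambda rho.
  by apply: lambda_noninc => //; rewrite (le_trans (ltW re)).
have D0 : 0 < lambda rho - lambda nu by rewrite subr_gt0 lt_neqAle eq_sym lneq.
have := pulls_gap l_ge1 sI n0 psa ks bI (le_trans gb Jr) rho1 nuE Dge0.
have := rank_weight_ge ga1 gan Jnu.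
move: (rank_weight J (g a)) => W hW hn.
move: hG; set D2 := (_ - _) ^+ 2 in hn *; have D20 : 0 < D2 by rewrite exprn_gt0.
rewrite ler_pdivrMr ?mulr_gt0// => hG.
move: hW; rewrite ler_pdivrMr// => hW.
move: hn; move: (_%:R : R) => n hn.
have l0 : 0 < l t by lra.
have lt0 : 0 <= l t * tau by apply: mulr_ge0 => //; exact: ltW.
(* n D2 nu <= 96 l zeta^2 nu <= 192 l tau rho D2 <= 384 l tau 2^-J D2, where
   [rho < 2 * 2^-J] is used last, and [W * nu >= 2^-J]. *)
have h1 : n * D2 * nu <= 96 * l t * (2 * tau * (rho * D2)).
  apply: (@le_trans _ _ (96 * zeta ^+ 2 * l t * nu)); first by rewrite ler_wpM2r// ltW.
  rewrite (_ : _ * nu = 96 * l t * (zeta ^+ 2 * nu)); last by ring.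
  by apply: ler_wpM2l; [lra|exact: hG].
have h2 : 96 * l t * (2 * tau * (rho * D2)) <= 384 * (l t * tau) * (W * nu) * D2.
  rewrite (_ : 96 * _ * _ = 192 * (l t * tau) * rho * D2); last by ring.
  apply: ler_wpM2r; first exact: ltW.
  rewrite (_ : 384 * (l t * tau) * (W * nu) =
    192 * (l t * tau) * (2 * (W * nu))); last by ring.
  by apply: ler_wpM2l; lra.
have := le_trans h1 h2.
rewrite (_ : n * D2 * nu = n * (nu * D2)); last by ring.
rewrite (_ : 384 * _ * _ * D2 = (384 * l t * tau * W) * (nu * D2)); last by ring.
by rewrite ler_pM2r// mulr_gt0.
Qed.

Hypothesis u_le1 : forall s, (0 < s)%N -> u s <= 1.
Hypothesis ln_le : ln t%:R <= l t.
Hypothesis scales : forall J, 2 ^+ 28 * l t ^+ 4 * 2 ^+ J <= t%:R ->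
  good_scale (l t) J t g u.

(** At the times when the scope is in the window of scale [J], only the arms
    below [2 * k] are pulled, and [pulls_rank_weight] leaves them too few pulls
    to account for all these times. *)
Lemma recommendation_rank (psi eta : R) : 1 <= l t -> 2 ^+ 30 * l t ^+ 4 <= psi ->
  reachable zeta lambda psi t eta -> g (r t) <= eta.
Proof.
move=> l_ge1 hpsi hreach; rewrite leNgt; apply/negP => er.
have l0 : 0 < l t by lra.
have l4 : 0 < l t ^+ 4 by rewrite exprn_gt0.
have psi0 : 0 < psi by apply: lt_le_trans hpsi; rewrite mulr_gt0// exprn_gt0.
have [rho [rho0 re rt gap]] := reachable_benchmark psi0 t_gt0 hreach.
have eta1 : eta < 1 by move: hreach => [/andP[]].
have tR : 0 < t%:R :> R by rewrite ltr0n.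
set tau := t%:R / psi in rt gap.
have tau0 : 0 < tau by rewrite divr_gt0.
have tE : t%:R = tau * psi by rewrite /tau divfK// gt_eqF.
have [J [Jr rJ]] := dyadic_scale rho0 (lt_trans re eta1).
have J0 : 0 < 2 ^+ J :> R by rewrite exprn_gt0.
have Jtau : 2 ^+ J <= 4 * tau.
  have : rho^-1 > 2 ^+ J / 2.
    rewrite -[ltLHS]invrK ltf_pV2 ?posrE ?invr_gt0 ?divr_gt0//.
    by rewrite invfM invrK mulrC.
  by lra.
have ht : 2 ^+ 30 * l t ^+ 4 * tau <= t%:R by rewrite tE mulrC ler_pM2l.
have [[b bI gb] hW hQ] : good_scale (l t) J t g u.
  apply: scales; apply: le_trans ht.
  rewrite (_ : 2 ^+ 30 * l t ^+ 4 * tau = 2 ^+ 28 * l t ^+ 4 * (4 * tau)); last by ring.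
  by rewrite ler_wpM2l// mulr_ge0 ?exprn_ge0// ltW.
set k := num_arms (l t) J in bI hW hQ.
have [b1 bk] := andP bI.
pose Q s := (2 * k <= s)%N && (k <= scope u s < 2 * k)%N.
have kl : k%:R <= 16 * l t * tau.
  apply: le_trans (num_arms_le J l_ge1) _.
  by rewrite (_ : 16 * l t * tau = 4 * l t * (4 * tau)) ?ler_wpM2l//; [lra|ring].
pose B a := 384 * l t * tau * rank_weight J (g a).
have hQ' : t%:R / (16 * l t) <= (\sum_(1 <= s < t.+1) Q s)%:R.
  apply: le_trans hQ _; rewrite natr_sum.
  have [kt|/ltnW kt] := leqP (2 * k) t.+1; last first.
    by rewrite [leLHS]big_geq// sumr_ge0.
  have k1 : (1 <= 2 * k)%N by rewrite muln_gt0.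
  rewrite [leRHS](big_cat_nat k1 kt)/=.
  rewrite -[leLHS]add0r lerD ?sumr_ge0//.
  rewrite !big_nat; apply: ler_sum => s /andP[ks _].
  rewrite ler_nat; case: (boolP (_ \in _)) => // /(scope_window (leq_trans b1 bk) ks) h.
  by rewrite /Q ks h.
have pI s : (0 < s)%N -> (1 <= p s <= scope u s)%N.
  by move=> s0; have [[]] := run s0.
have ltau : 0 <= 384 * l t * tau.
  by apply: mulr_ge0; [lra|exact: ltW].
have h : (\sum_(1 <= s < t.+1) Q s)%:R <= \sum_(1 <= a < 2 * k) (1 + B a).
  apply: (sum_window_le (p := p)).
  - by move=> a; apply: mulr_ge0 => //; exact: rank_weight_ge0.
  - move=> s /andP[s0 st] /and3P[ks k1 k2]; have /andP[p1 p2] := pI s s0.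
    by rewrite p1 (leq_ltn_trans p2).
  - move=> a s sI /and3P[ks k1 k2] psa.
    by apply: (@pulls_rank_weight J k b a s rho eta) => //; exact: ltW.
rewrite big_split/= sumr_const_nat -mulr_sumr in h.
have := le_trans hQ' h; apply/negP; rewrite -ltNge.
have tauJ : 2 ^+ J <= t%:R :> R.
  apply: le_trans Jtau (le_trans _ ht); rewrite ler_pM2r//.
  apply: (@le_trans _ _ (2 ^+ 30)).
    by rewrite (_ : 4 = 2 ^+ 2) ?ler_weXn2l ?ler1n//; ring.
  by rewrite ler_peMr ?exprn_ge0// exprn_ege1.
have Jl : J.+1%:R <= 3 * l t.
  have : ln (2 ^+ J) <= l t by apply: le_trans ln_le; rewrite ler_ln ?posrE.
  rewrite lnXn ?ltr0n// -(mulr_natr (ln 2)) => hJ.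
  have : 2^-1 * J%:R <= ln 2 * J%:R :> R by rewrite ler_wpM2r// ln2_ge_half.
  by rewrite -[J.+1%:R](natr1 J); lra.
have hk : (2 * k - 1)%:R <= 32 * l t * tau.
  apply: (@le_trans _ _ (2 * k)%:R); first by rewrite ler_nat leq_subr.
  by rewrite natrM; lra.
have hW' : \sum_(1 <= a < 2 * k) rank_weight J (g a) <= 120 * l t ^+ 2.
  apply: le_trans hW _; rewrite expr2.
  have : l t * J.+1%:R <= l t * (3 * l t) by rewrite ler_wpM2l// ltW.
  have : l t <= l t * l t by rewrite ler_peMl// ltW.
  by rewrite -!mulrA; lra.
have ltau3 : 0 < l t ^+ 3 * tau by rewrite mulr_gt0// exprn_gt0.
(* The constants: 32 + 384 * 120 < 2^17, and 2^17 * 16 = 2^21 < 2^30. *)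
apply: (@le_lt_trans _ _ (2 ^+ 17 * (l t ^+ 3 * tau))).
  have : l t * tau <= l t ^+ 3 * tau.
    apply: ler_wpM2r; first exact: ltW.
    by rewrite -[X in X <= _]expr1 ler_weXn2l.
  have := ler_wpM2l ltau hW'.
  rewrite (_ : 384 * l t * tau * (120 * l t ^+ 2) =
    384 * 120 * (l t ^+ 3 * tau)); last by ring.
  move: hk; rewrite -[32 * _ * _]mulrA.
  move: (l t * tau) (l t ^+ 3 * tau) ltau3 => y z z0.
  move: (384 * _ * _ * _) ((2 * k - 1)%:R : R) => v w hw hv hy.
  by lra.
rewrite ltr_pdivlMr ?mulr_gt0//; apply: lt_le_trans ht.
rewrite (_ : 2 ^+ 17 * (l t ^+ 3 * tau) * (16 * l t) =
  2 ^+ 21 * (l t ^+ 4 * tau)); last by ring.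
by rewrite -mulrA (ltr_pM2r (mulr_gt0 l4 tau0)) ltr_eXn2l// ltr1n.
Qed.
End Run.

(** * Tails for the ranks and the scopes *)

Lemma indic_preimage_itv (R : realType) (T : Type) (f : T -> R)
  (I : interval R) (w : T) : \1_(f @^-1` [set` I]) w = (f w \in I)%:R :> R.
Proof.
rewrite indicE; suff -> : (w \in f @^-1` [set` I]) = (f w \in I) by [].
by apply/idP/idP; rewrite inE.
Qed.

Lemma measurable_rank_weight (R : realType) (J : nat) :
  measurable_fun setT (rank_weight J : R -> R).
Proof.
apply: measurable_funM => //; apply: measurable_sum => j.
apply: measurable_funM => //.
rewrite (_ : (fun g => _) = \1_`]-oo, (2 ^- j : R)]); first exact: measurable_indic.
by apply/funext => g; rewrite indicE mem_setE in_itv.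
Qed.

Lemma rank_weight_le4 (R : realType) (J : nat) (g : R) : rank_weight J g <= 4.
Proof.
rewrite /rank_weight ler_pdivrMr ?exprn_gt0//.
suff: \sum_(j < J.+1) 2 ^+ j.+1 * (g <= 2 ^- j)%R%:R + 2 <= 4 * 2 ^+ J :> R by lra.
elim: J => [|J IH].
  rewrite big_ord_recr big_ord0/= expr1 expr0.
  by case: (g <= _); rewrite /=; lra.
rewrite big_ord_recr/= !exprS.
have p0 : 0 <= 2 ^+ J :> R by rewrite exprn_ge0.
by move: (\sum_(j < J.+1) _) IH => S IH; case: (g <= _); rewrite /=; lra.
Qed.

Lemma expR_le1D2 (R : realType) (y : R) : 0 <= y <= 2^-1 -> expR y <= 1 + 2 * y.
Proof.
move=> /andP[y0 y1]; apply: le_trans (expR_le_inv _) _; first by lra.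
rewrite -[leLHS]mul1r ler_pdivrMr; last by lra.
have : 0 <= y * (1 - 2 * y) by apply: mulr_ge0 => //; lra.
by rewrite mulrBr mulr1 mulrCA; lra.
Qed.

(** The weight of a uniform rank has mean 2 (J + 1) / 2^J and takes its values
    in [0, 4], so that the exponential of an eighth of it is at most an affine
    function of it ([expR_le1D2]). *)
Lemma rank_weight_tail (R : realType) (d : measure_display)
  (T : measurableType d) (P : probability T R) (X : nat -> {RV P >-> R})
  (J n : nat) (l : R) :
  mutually_independent P (fun i => sigma_of (X i)) ->
  (forall i, uniform01 (X i)) -> 0 <= l -> n%:R <= 8 * l * 2 ^+ J ->
  (P [set w | (32 * l * J.+1%:R + 24 * l <=
               \sum_(0 <= i < n) rank_weight J (X i w))%R]
    <= (expR (- (3 * l)))%:E)%E.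
Proof.
move=> indep unifX l0 hn.
pose f (i : nat) (z : R) := rank_weight J z / 8.
have mf i : measurable_fun setT (f i).
  by apply: measurable_funM => //; exact: measurable_rank_weight.
have J0 : 0 < 2 ^+ J :> R by rewrite exprn_gt0.
pose kappa (i : nat) : R := J.+1%:R / 2 / 2 ^+ J.
have fk i : i \in index_iota 0 n ->
    (\int[P]_w (expR (f i (X i w)))%:E <= (expR (kappa i))%:E)%E.
  move=> _.
  pose c j : R := 2 ^+ j.+1 / 2 ^+ J / 4.
  apply: (@le_trans _ _ (\int[P]_w (1 + \sum_(j < J.+1)
      c j * \1_(X i @^-1` `]-oo, (2 ^- j : R)]) w)%:E)%E).
    apply: ge0_le_integral => //.
    - by apply/measurable_EFinP; apply: measurableT_comp => //; apply: measurableT_comp.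
    - apply/measurable_EFinP; apply: measurable_funD => //.
      apply: measurable_sum => j; apply: measurable_funM => //.
      by apply: measurable_indic; exact: measurable_preimage_RV.
    - move=> w _; rewrite lee_fin; apply: le_trans (expR_le1D2 _) _.
        have := rank_weight_ge0 J (X i w); have := rank_weight_le4 J (X i w).
        by rewrite /f; lra.
      rewrite lerD2l /f /rank_weight le_eqVlt; apply/orP; left; apply/eqP.
      rewrite !mulr_suml mulr_sumr; apply: eq_bigr => j _.
      rewrite indic_preimage_itv in_itv/= /c.
      by move: ((X i w <= 2 ^- j)%R%:R : R) => b; field; rewrite gt_eqF.
  rewrite (@integral_indic_comb _ _ _ P J.+1 1 c (fun j => 2 ^- j)
    (fun j => X i @^-1` `]-oo, (2 ^- j : R)]))//.
  - rewrite lee_fin; apply: le_trans (expR_ge1Dx _); rewrite lerD2l.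
    rewrite (eq_bigr (fun=> 2 / 2 ^+ J / 4)); last first.
      move=> j _; rewrite /c exprS; field.
      by rewrite !gt_eqF ?exprn_gt0.
    rewrite sumr_const card_ord -(mulr_natr (2 / 2 ^+ J / 4)) /kappa.
    rewrite le_eqVlt; apply/orP; left; apply/eqP.
    by move: (J.+1%:R : R) => m; field; rewrite gt_eqF.
  - by move=> j; rewrite !divr_ge0 ?exprn_ge0.
  - by move=> j; exact: measurable_preimage_RV.
  - move=> j _; apply: uniform01_le => //.
    by rewrite invf_le1 ?exprn_gt0// exprn_ege1// ler1n.
have := @chernoff _ _ _ P X f kappa (index_iota 0 n)
  (4 * l * J.+1%:R + 3 * l) indep mf fk (iota_uniq _ _).
have -> : [set w | 4 * l * J.+1%:R + 3 * l <=
      \sum_(i <- index_iota 0 n) f i (X i w)] =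
    [set w | 32 * l * J.+1%:R + 24 * l <=
      \sum_(0 <= i < n) rank_weight J (X i w)].
  have e w : \sum_(i <- index_iota 0 n) f i (X i w) =
      (\sum_(0 <= i < n) rank_weight J (X i w)) / 8 by rewrite mulr_suml.
  by apply/seteqP; split=> w /=; rewrite e; lra.
move=> /le_trans; apply; rewrite lee_fin ler_expR.
rewrite /kappa sumr_const_nat subn0 -(mulr_natr (J.+1%:R / 2 / 2 ^+ J)).
have : J.+1%:R / 2 / 2 ^+ J * n%:R <= J.+1%:R / 2 / 2 ^+ J * (8 * l * 2 ^+ J) :> R.
  by rewrite ler_wpM2l// !divr_ge0// exprn_ge0.
have -> : J.+1%:R / 2 / 2 ^+ J * (8 * l * 2 ^+ J) = 4 * l * J.+1%:R :> R.
  by move: (J.+1%:R : R) => m; field; rewrite gt_eqF.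
by lra.
Qed.

Lemma no_low_rank (R : realType) (d : measure_display)
  (T : measurableType d) (P : probability T R) (X : nat -> {RV P >-> R})
  (n : nat) (q : R) :
  mutually_independent P (fun i => sigma_of (X i)) ->
  (forall i, uniform01 (X i)) -> 0 <= q -> q <= 1 ->
  (P (\bigcap_(i in [set` iota 0 n]) X i @^-1` `]q, +oo[)
    <= (expR (- (n%:R * q)))%:E)%E.
Proof.
move=> indep unifX q0 q1.
rewrite (mutually_independent_seq indep (iota_uniq _ _)); last first.
  by move=> i _; exists `]q, +oo[%classic => //; rewrite setTI.
under eq_bigr do rewrite uniform01_gt//.
rewrite -(big_morph EFin EFinM erefl) lee_fin.
apply: (@le_trans _ _ (\prod_(i <- iota 0 n) expR (- q))).
  by apply: ler_prod => i _; rewrite subr_ge0 q1 expR_ge1Dx.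
by rewrite -expR_sum big_const_seq count_predT size_iota iter_addr_0 mulNrn mulr_natl.
Qed.

(** Since e^-1 <= 1/2, the exponential of minus the indicator of an event of
    probability at least [p] has mean at most 1 - p / 2. *)
Lemma window_tail (R : realType) (d : measure_display)
  (T : measurableType d) (P : probability T R) (X : nat -> {RV P >-> R})
  (a b : nat -> R) (m n : nat) (p x : R) :
  mutually_independent P (fun i => sigma_of (X i)) ->
  (forall i, uniform01 (X i)) ->
  (forall i, (m <= i < n)%N -> [/\ 0 <= a i, a i <= b i, b i <= 1 & p <= b i - a i]) ->
  (P [set w | (\sum_(m <= i < n) (X i w \in `[a i, b i[)%:R <= x)%R]
    <= (expR (x - (n - m)%:R * (p / 2)))%:E)%E.
Proof.
move=> indep unifX hab.
pose f (i : nat) (z : R) : R := - (z \in `[a i, b i[)%:R.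
have mf i : measurable_fun setT (f i).
  rewrite (_ : f i = -%R \o \1_`[a i, b i[); last first.
    by apply/funext => z; rewrite /f /= indicE mem_setE.
  by apply: measurableT_comp => //; exact: measurable_indic.
pose kappa (i : nat) : R := - (p / 2).
have fk i : i \in index_iota m n ->
    (\int[P]_w (expR (f i (X i w)))%:E <= (expR (kappa i))%:E)%E.
  rewrite mem_index_iota => /hab[a0 ab b1 pab].
  pose A := X i @^-1` `[a i, b i[.
  have mA : measurable A by exact: measurable_preimage_RV.
  apply: (@le_trans _ _ (\int[P]_w (2^-1 + \sum_(j < 1) 2^-1 * \1_(~` A) w)%:E)%E).
    apply: ge0_le_integral => //.
    - by apply/measurable_EFinP; apply: measurableT_comp => //; apply: measurableT_comp.
    - apply/measurable_EFinP; apply: measurable_funD => //.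
      apply: measurable_sum => j; apply: measurable_funM => //.
      by apply: measurable_indic; exact: measurableC.
    - move=> w _; rewrite lee_fin big_ord1 indicE in_setC.
      rewrite /f -(indic_preimage_itv (X i)) -/A indicE.
      case: (w \in A) => /=; last by rewrite oppr0 expR0; lra.
      rewrite mulr0 addr0 expRN lef_pV2 ?posrE ?expR_gt0//.
      by apply: le_trans (expR_ge1Dx _); lra.
  rewrite (@integral_indic_comb _ _ _ P 1 2^-1 (fun=> 2^-1)
    (fun=> 1 - (b i - a i)) (fun=> ~` A))//.
  - rewrite lee_fin big_ord1; apply: le_trans (expR_ge1Dx _).
    by rewrite /kappa; lra.
  - by move=> _; exact: measurableC.
  - by move=> _ _; rewrite probability_setC// uniform01_itvco.
have := @chernoff _ _ _ P X f kappa (index_iota m n) (- x) indep mf fk (iota_uniq _ _).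
have -> : [set w | - x <= \sum_(i <- index_iota m n) f i (X i w)] =
    [set w | \sum_(m <= i < n) (X i w \in `[a i, b i[)%:R <= x].
  by apply/seteqP; split=> w /=; rewrite sumrN lerN2.
move=> /le_trans; apply; rewrite lee_fin ler_expR.
rewrite /kappa sumr_const_nat opprK mulNrn -(mulr_natr (p / 2)).
by rewrite [p / 2 * _]mulrC addrC.
Qed.

(** * Failure events *)

Lemma union_bound2 (R : realType) (d : measure_display)
  (T : measurableType d) (P : probability T R) (A B : set T) (a b : R) :
  measurable A -> measurable B -> (P A <= a%:E)%E -> (P B <= b%:E)%E ->
  (P (A `|` B) <= (a + b)%:E)%E.
Proof.
by move=> mA mB hA hB; apply: le_trans (measureU2 _ mA mB) _; rewrite EFinD leeD.
Qed.

Lemma union_bound_ord (R : realType) (d : measure_display)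
  (T : measurableType d) (P : probability T R) (n : nat) (A : nat -> set T)
  (a : R) :
  (forall i, (i < n)%N -> measurable (A i)) ->
  (forall i, (i < n)%N -> (P (A i) <= a%:E)%E) ->
  (P (\bigcup_(i < n) A i) <= (n%:R * a)%:E)%E.
Proof.
move=> mA hA; rewrite bigcup_mkord; apply: le_trans (Boole_inequality _ mA) _.
apply: (@le_trans _ _ (\sum_(i < n) a%:E)%E); first by apply: lee_sum => i _; exact: hA.
by rewrite sumEFin sumr_const card_ord mulr_natl.
Qed.

Lemma union_bound_nat (R : realType) (d : measure_display)
  (T : measurableType d) (P : probability T R) (A : nat -> set T)
  (c : nat -> R) (delta : R) :
  (forall i, measurable (A i)) -> (forall i, (P (A i) <= (c i)%:E)%E) ->
  (forall n, \sum_(0 <= i < n) c i <= delta) ->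
  (P (\bigcup_i A i) <= delta%:E)%E.
Proof.
move=> mA hA hc.
have mU : measurable (\bigcup_i A i) by exact: bigcup_measurable.
apply: le_trans (generalized_Boole_inequality _ mA mU) _.
apply: lime_le; first by apply: is_cvg_nneseries => n _ _; exact: measure_ge0.
apply: nearW => n; apply: (@le_trans _ _ (\sum_(0 <= i < n) (c i)%:E)%E).
  by apply: lee_sum => i _; exact: hA.
by rewrite sumEFin lee_fin.
Qed.

Lemma sum_telescope_le (R : realType) (delta : R) (n : nat) : 0 <= delta ->
  \sum_(0 <= m < n) delta / (m.+1%:R * m.+2%:R) <= delta.
Proof.
move=> d0; suff -> : \sum_(0 <= m < n) delta / (m.+1%:R * m.+2%:R) =
    delta - delta / n.+1%:R.
  by rewrite gerBl divr_ge0.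
elim: n => [|n IH]; first by rewrite big_geq// divr1 subrr.
rewrite big_nat_recr//= IH -[in LHS](natr1 n.+1) -[in RHS](natr1 n.+1).
have : 0 < n.+1%:R :> R by rewrite ltr0n.
move: (n.+1%:R : R) => m m0; field.
by rewrite !gt_eqF// addr_gt0.
Qed.

Section Events.
Variables (R : realType) (d : measure_display) (T : measurableType d).
Variables (P : probability T R).
Implicit Types (gamma U : nat -> {RV P >-> R}) (l x : R) (J k n t : nat).

Definition no_low_arm gamma J k : set T :=
  \bigcap_(i in [set` iota 0 k]) gamma i.+1 @^-1` `]2 ^- J, +oo[.

Definition heavy_arms gamma x J n : set T :=
  [set w | x <= \sum_(0 <= i < n) rank_weight J (gamma i.+1 w)].

Definition rare_window U x k t : set T :=
  [set w | \sum_((2 * k).-1 <= i < t) (U i.+1 w \in window R k i.+1)%:R <= x].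

(** The three parts negate the three parts of [good_scale], with indices
    shifted so that the variables are numbered from 0. *)
Definition scale_failure gamma U l J t : set T :=
  let k := num_arms l J in
  no_low_arm gamma J k `|`
  heavy_arms gamma (32 * l * J.+1%:R + 24 * l) J (2 * k).-1 `|`
  rare_window U (t%:R / (16 * l)) k t.

Lemma measurable_no_low_arm gamma J k : measurable (no_low_arm gamma J k).
Proof.
apply: fin_bigcap_measurable => [|i _]; first exact: finite_seq.
exact: measurable_preimage_RV.
Qed.

Lemma measurable_heavy_arms gamma x J n : measurable (heavy_arms gamma x J n).
Proof.
apply: measurable_superlevel; apply: measurable_sum => i.
by apply: measurableT_comp => //; exact: measurable_rank_weight.
Qed.

Lemma measurable_rare_window U x k t : measurable (rare_window U x k t).
Proof.
rewrite /rare_window (_ : mkset _ = [set w | - x <=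
    - \sum_((2 * k).-1 <= i < t) (U i.+1 w \in window R k i.+1)%:R]); last first.
  by apply/seteqP; split=> w /=; rewrite lerN2.
apply: measurable_superlevel; apply: measurableT_comp => //.
apply: measurable_sum => i.
under eq_fun do rewrite -(indic_preimage_itv (U i.+1)).
by apply: measurable_indic; exact: measurable_preimage_RV.
Qed.

Lemma measurable_scale_failure gamma U l J t :
  measurable (scale_failure gamma U l J t).
Proof.
apply: measurableU; last exact: measurable_rare_window.
apply: measurableU; first exact: measurable_no_low_arm.
exact: measurable_heavy_arms.
Qed.

Lemma scale_failureN gamma U l J t w :
  ~ scale_failure gamma U l J t w -> good_scale l J t (gamma ^~ w) (U ^~ w).
Proof.
rewrite /good_scale /scale_failure.
move: (num_arms l J) (isT : (0 < num_arms l J)%N) => k k0 hw.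
have [h1 h2 h3] : [/\ ~ no_low_arm gamma J k w,
    ~ heavy_arms gamma (32 * l * J.+1%:R + 24 * l) J (2 * k).-1 w &
    ~ rare_window U (t%:R / (16 * l)) k t w].
  by split=> h; apply: hw; [left; left|left; right|right].
have kE : (2 * k = (2 * k).-1.+1)%N by rewrite prednK// muln_gt0.
split.
- apply: contrapT => hn; apply: h1 => i; rewrite /= mem_iota add0n => /andP[_ ik].
  rewrite /= in_itv/= andbT ltNge; apply/negP => hi; apply: hn.
  by exists i.+1.
- by rewrite kE big_add1/=; move: h2 => /negP; rewrite -ltNge => /ltW.
- rewrite [X in \sum_(X <= _ < _) _]kE big_add1/=.
  by move: h3 => /negP; rewrite -ltNge => /ltW.
Qed.

(** From the time [2 * k] on, where [k] is [num_arms l J], the windows are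
    subintervals of [0, 1] of length at least [(2 * l)^-1]. The assumption on [t]
    gives [4 * k <= t], so that these are at least half of the times up to [t],
    and [48 * l ^+ 2 <= t], so that their number is concentrated enough. *)
Lemma scale_failure_prob gamma U l J t :
  mutually_independent P (fun i => sigma_of (gamma i.+1)) ->
  mutually_independent P (fun i => sigma_of (U i.+1)) ->
  (forall i, uniform01 (gamma i.+1)) -> (forall i, uniform01 (U i.+1)) ->
  (0 < t)%N -> 1 <= l -> ln t%:R <= l ->
  2 ^+ 28 * l ^+ 4 * 2 ^+ J <= t%:R ->
  (P (scale_failure gamma U l J t) <= (3 * expR (- (3 * l)))%:E)%E.
Proof.
move=> indepg indepU ug uU t0 l1 lnt adm.
have tR : 0 < t%:R :> R by rewrite ltr0n.
have l0 : 0 < l by exact: lt_le_trans l1.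
have J0 : 0 < 2 ^+ J :> R by rewrite exprn_gt0.
rewrite /scale_failure.
move: (num_arms l J) (isT : (0 < num_arms l J)%N) (num_arms_le J l1)
  (num_arms_ge l J) => k k0 kl kg.
have lJ : l * 2 ^+ J <= l ^+ 4 * 2 ^+ J.
  by apply: ler_wpM2r; [exact: ltW|rewrite -[X in X <= _]expr1 ler_weXn2l].
have p28 : 2 ^+ 6 <= 2 ^+ 28 :> R by rewrite ler_weXn2l// ler1n.
have l4J : 0 < l ^+ 4 * 2 ^+ J by rewrite mulr_gt0// exprn_gt0.
have tJ : 2 ^+ 6 * (l ^+ 4 * 2 ^+ J) <= t%:R.
  by apply: le_trans adm; rewrite -mulrA; apply: ler_wpM2r => //; exact: ltW.
have kt : (4 * k)%:R <= t%:R :> R.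
  apply: le_trans tJ; rewrite natrM (_ : 2 ^+ 6 = 4 * 16 :> R); last by ring.
  by rewrite -!mulrA in kl *; lra.
have tl2 : 48 * l ^+ 2 <= t%:R.
  apply: le_trans tJ.
  have : l ^+ 2 <= l ^+ 4 * 2 ^+ J.
    apply: (@le_trans _ _ (l ^+ 4)); first by rewrite ler_weXn2l.
    by rewrite ler_peMr ?exprn_ge0 ?exprn_ege1// ?ler1n// ltW.
  by rewrite (_ : 2 ^+ 6 = 64 :> R); [move=> h; lra|ring].
have {}kt : (4 * k <= t)%N by rewrite -(ler_nat R).
have e3 : 3 * expR (- (3 * l)) =
    expR (- (3 * l)) + expR (- (3 * l)) + expR (- (3 * l)) :> R by ring.
rewrite e3; apply: union_bound2.
- apply: measurableU; first exact: measurable_no_low_arm.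
  exact: measurable_heavy_arms.
- exact: measurable_rare_window.
- apply: union_bound2.
  + exact: measurable_no_low_arm.
  + exact: measurable_heavy_arms.
  + apply: le_trans (no_low_rank k indepg ug _ _) _.
    * by rewrite invr_ge0 ltW.
    * by rewrite invf_le1// exprn_ege1// ler1n.
    * by rewrite lee_fin ler_expR lerN2 ler_pdivlMr.
  + apply: rank_weight_tail => //; first exact: ltW.
    apply: (@le_trans _ _ (2 * k)%:R); first by rewrite ler_nat leq_pred.
    by rewrite natrM -!mulrA in kl *; lra.
- apply: le_trans (@window_tail _ _ _ P (fun i => U i.+1)
    (fun i => ln k%:R / ln i.+1%:R) (fun i => ln (2 * k)%:R / ln i.+1%:R)
    _ _ (2^-1 / l) _ indepU uU _) _.
    move=> i /andP[ki it].
    have i1 : (2 * k <= i.+1)%N by rewrite -ltnS prednK ?muln_gt0// in ki.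
    have ip : 0 < ln (i.+1%:R : R) by rewrite ln_gt0// ltr1n; clear -k0 i1; lia.
    have lk0 : 0 <= ln (k%:R : R) by rewrite ln_ge0// ler1n.
    have il : ln (i.+1%:R : R) <= l.
      by apply: le_trans lnt; rewrite ler_ln ?posrE ?ltr0n// ler_nat.
    split.
    + by rewrite divr_ge0// ltW.
    + rewrite ler_pM2r ?invr_gt0// ler_ln ?posrE ?ltr0n ?muln_gt0// ler_nat.
      by rewrite leq_pmull.
    + by rewrite ler_pdivrMr// mul1r ler_ln ?posrE ?ltr0n ?muln_gt0// ler_nat.
    + rewrite -mulrBl natrM lnM ?posrE ?ltr0n// addrK.
      apply: ler_pM => //; [|exact: ln2_ge_half|by rewrite lef_pV2 ?posrE].
      by rewrite invr_ge0 ltW.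
  rewrite lee_fin ler_expR.
  have tl : 3 * l <= t%:R / (16 * l).
    by rewrite ler_pdivlMr ?mulr_gt0//; rewrite expr2 in tl2; lra.
  have nt : t%:R / 2 <= (t - (2 * k).-1)%:R :> R.
    rewrite ler_pdivrMr// -natrM ler_nat; clear -kt; lia.
  have : t%:R / 2 * (2^-1 / l / 2) <= (t - (2 * k).-1)%:R * (2^-1 / l / 2).
    by apply: ler_wpM2r => //; rewrite !divr_ge0// ?invr_ge0// ltW.
  have -> : t%:R / 2 * (2^-1 / l / 2) = 2 * (t%:R / (16 * l)).
    by move: (t%:R : R) => s; field; rewrite gt_eqF.
  by lra.
Qed.

Definition noise_failure (eps : nat -> nat -> {RV P >-> R}) (zeta b : R)
    (a n : nat) : set T :=
  [set w | n%:R * Num.sqrt (zeta ^+ 2 * b / n%:R) <=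
           `|\sum_(0 <= i < n) eps a i.+1 w|].

Lemma measurable_noise_failure (eps : nat -> nat -> {RV P >-> R}) (zeta b : R)
    (a n : nat) :
  measurable (noise_failure eps zeta b a n).
Proof.
apply: measurable_superlevel; apply: measurableT_comp => //.
by apply: measurable_sum.
Qed.

Lemma noise_failure_prob (eps : nat -> nat -> {RV P >-> R}) (zeta b : R)
    (a n : nat) : 0 < zeta -> 0 < b -> (0 < n)%N ->
  mutually_independent P (fun i => sigma_of (eps a i.+1)) ->
  (forall i, subgaussian zeta (eps a i.+1)) ->
  (P (noise_failure eps zeta b a n) <= (2 * expR (- (b / 2)))%:E)%E.
Proof.
move=> zeta0 b0 n0 indep subg.
pose side sgn := [set w | n%:R * Num.sqrt (zeta ^+ 2 * b / n%:R) <=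
               \sum_(0 <= i < n) sgn * eps a i.+1 w].
have mside s : measurable (side s).
  apply: measurable_superlevel; apply: measurable_sum => i.
  by apply: measurable_funM.
have hside s : s ^+ 2 = 1 -> (P (side s) <= (expR (- (b / 2)))%:E)%E.
  by move=> s2; exact: (subgaussian_sum_tail zeta0 b0 n0 s2 indep subg).
have -> : noise_failure eps zeta b a n = side 1 `|` side (-1).
  apply/seteqP; split=> w; rewrite /noise_failure /side /=;
    rewrite -!mulr_sumr mul1r mulN1r ler_normr; first by move=> /orP.
  by move=> ?; apply/orP.
rewrite mulr2n mulrDl mul1r; apply: union_bound2 => //; apply: hside.
  by rewrite expr1n.
by rewrite sqrrN expr1n.
Qed.
End Events.

(** * The time-uniform guarantee *)

Lemma budget_ge1 (R : realType) (delta : R) (t : nat) :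
  0 < delta -> delta < 1 -> (0 < t)%N -> 1 <= ln (5 * t%:R / delta).
Proof.
move=> d0 d1 t0; rewrite -[leLHS]expRK ler_ln ?posrE ?expR_gt0//; last first.
  by rewrite divr_gt0 ?mulr_gt0 ?ltr0n.
apply: le_trans (expR1_le4 R) _; rewrite ler_pdivlMr//.
have : 1 <= t%:R :> R by rewrite ler1n.
by lra.
Qed.

Lemma budget_le (R : realType) (delta : R) (s t : nat) :
  0 < delta -> (0 < s <= t)%N -> ln (5 * s%:R / delta) <= ln (5 * t%:R / delta).
Proof.
move=> d0 /andP[s0 st]; have t0 := leq_trans s0 st.
rewrite ler_ln ?posrE ?divr_gt0 ?mulr_gt0 ?ltr0n//.
by rewrite ler_pM2r ?invr_gt0// ler_pM2l// ler_nat.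
Qed.

Lemma ln_le_budget (R : realType) (delta : R) (t : nat) :
  0 < delta -> delta < 1 -> (0 < t)%N -> ln t%:R <= ln (5 * t%:R / delta).
Proof.
move=> d0 d1 t0; have tR : 0 < t%:R :> R by rewrite ltr0n.
rewrite ler_ln ?posrE ?divr_gt0 ?mulr_gt0//.
rewrite ler_pdivlMr//; have : t%:R * delta <= t%:R * 1 by rewrite ler_pM2l// ltW.
by lra.
Qed.

(** At time [m + 1] there are at most [m + 1] scales, each failing with
    probability 3 (delta / (5 (m + 1)))^3, and [m + 1] times two pairs of an arm
    and a number of pulls, each failing with probability 2 (delta / (5 (m + 1)))^3;
    the right-hand side telescopes. *)
Lemma budget_failure (R : realType) (delta : R) (m : nat) :
  0 < delta -> delta < 1 ->
  m.+1%:R * (7 * expR (- (3 * ln (5 * m.+1%:R / delta)))) <=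
    delta / (m.+1%:R * m.+2%:R).
Proof.
move=> d0 d1; have m0 : 1 <= m.+1%:R :> R by rewrite ler1n.
rewrite -[m.+2%:R](natr1 m.+1); move: (m.+1%:R : R) m0 => s s1.
have s0 : 0 < s by exact: lt_le_trans s1.
have y0 : 0 < 5 * s / delta by rewrite divr_gt0 ?mulr_gt0.
have -> : expR (- (3 * ln (5 * s / delta))) = (5 * s / delta) ^- 3.
  by rewrite expRN expRM_natl lnK ?posrE.
rewrite ler_pdivlMr ?mulr_gt0 ?addr_gt0//.
have -> : s * (7 * (5 * s / delta) ^- 3) * (s * (s + 1)) =
    delta * (delta ^+ 2 * (7 * (s + 1) / (125 * s))).
  by field; rewrite !gt_eqF.
rewrite -[leRHS]mulr1 ler_pM2l// mulr_ile1//.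
- by rewrite exprn_ge0// ltW.
- by rewrite divr_ge0 ?mulr_ge0// ?addr_ge0// ltW.
- by rewrite exprn_ile1// ltW.
- by rewrite ler_pdivrMr ?mulr_gt0//; lra.
Qed.

(** An arm pulled [n] times has received its first [n] rewards, so that a
    bound on the sum of its first [n] noise variables gives the confidence
    interval at every time with a larger [beta]. *)
Lemma emp_mean_deviation (R : realType) (zeta : R) (beta : nat -> R)
  (mu : R) (e : nat -> nat -> R) (x : nat -> nat -> R) (p : nat -> nat)
  (a t m : nat) :
  (forall i, x a i = mu + e a i) -> (0 < npulls p a t)%N -> beta m <= beta t ->
  `|\sum_(0 <= i < npulls p a t) e a i.+1| <
    (npulls p a t)%:R * Num.sqrt (zeta ^+ 2 * beta m / (npulls p a t)%:R) ->
  `|emp_mean x p a t - mu| <= width zeta beta p a t.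
Proof.
move=> hx; rewrite /emp_mean /width; move: (npulls p a t) => n n0 bmt hn.
have nR : 0 < n%:R :> R by rewrite ltr0n.
have -> : (\sum_(1 <= s < n.+1) x a s) / n%:R - mu =
    (\sum_(0 <= i < n) e a i.+1) / n%:R.
  rewrite big_add1/=; under eq_bigr do rewrite hx.
  rewrite big_split/= sumr_const_nat subn0 -[mu *+ n]mulr_natr.
  by move: (n%:R : R) nR => s s0; field; rewrite gt_eqF.
rewrite normrM [X in _ * X]gtr0_norm ?invr_gt0// ler_pdivrMr// mulrC.
apply: le_trans (ltW hn) _; apply: ler_wpM2l; first exact: ltW.
apply: ler_wsqrtr; apply: ler_wpM2r; first by rewrite invr_ge0 ltW.
by apply: ler_wpM2l => //; exact: sqr_ge0.
Qed.

Theorem theorem2p1 (R : realType) (d : measure_display) (T : measurableType d)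
  (P : probability T R)
  (lambda : R -> R)
  (lambda_noninc : forall x y : R, 0 < x -> x <= y -> y <= 1 ->
     lambda y <= lambda x)
  (lambda_rcont : forall x : R, 0 < x -> x < 1 ->
     lambda y @[y --> x^'+] --> lambda x)
  (zeta : R) (zeta_gt0 : 0 < zeta)
  (dW : measure_display) (W : measurableType dW)
  (gamma : nat -> {RV P >-> R}) (eps : nat -> nat -> {RV P >-> R})
  (U : nat -> {RV P >-> R}) (seed : {RV P >-> W})
  (indep : mutually_independent P (sources gamma eps U seed))
  (gamma_unif : forall a, (0 < a)%N -> uniform01 (gamma a))
  (eps_centered : forall a s, (0 < a)%N -> (0 < s)%N -> ('E_P[eps a s] = 0)%E)
  (eps_subgauss : forall a s, (0 < a)%N -> (0 < s)%N ->
     subgaussian zeta (eps a s))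
  (U_unif : forall t, (0 < t)%N -> uniform01 (U t))
  (delta : R) (delta_gt0 : 0 < delta) (delta_lt1 : delta < 1)
  (psi : nat -> R)
  (psi_ge : forall t, (0 < t)%N ->
     2 ^+ 30 * ln (5 * t%:R / delta) ^+ 4 <= psi t)
  (ahat rhat : nat -> T -> nat)
  (OSE : OSE_run P zeta (fun t => 6 * ln (5 * t%:R / delta)) seed U
     (reward lambda gamma eps) ahat rhat) :
  exists E : set T,
    [/\ measurable E,
        ((1 - delta)%:E <= P E)%E
      & forall w, E w -> forall t, (0 < t)%N ->
          gamma (rhat t w) w <= eta_star zeta lambda (psi t) t /\
          lambda (eta_star zeta lambda (psi t) t)
            <= lambda (gamma (rhat t w) w)].
Proof.
pose l t : R := ln (5 * t%:R / delta).
have l1 t : (0 < t)%N -> 1 <= l t by exact: budget_ge1.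
have indepg : mutually_independent P (fun i => sigma_of (gamma i.+1)).
  by apply: (@mutually_independent_comp _ _ _ P _ _ _
    (fun i => inl (inl (inl i))) _ indep) => i j [].
have indepU : mutually_independent P (fun i => sigma_of (U i.+1)).
  by apply: (@mutually_independent_comp _ _ _ P _ _ _
    (fun i => inl (inr i)) _ indep) => i j [].
have indepe a : mutually_independent P (fun i => sigma_of (eps a.+1 i.+1)).
  by apply: (@mutually_independent_comp _ _ _ P _ _ _
    (fun i => inl (inl (inr (a, i)))) _ indep) => i j [].
pose noise m := \bigcup_(i < m)
  (noise_failure eps zeta (6 * l m) i.+1 m `|`
   noise_failure eps zeta (6 * l m) m i.+1).
pose scale m := \bigcup_(J < m)
  (if 2 ^+ 28 * l m ^+ 4 * 2 ^+ J <= m%:R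
   then scale_failure gamma U (l m) J m else set0).
pose bad m := noise m.+1 `|` scale m.+1.
have mnoise m : measurable (noise m).
  apply: bigcup_measurable => i _.
  by apply: measurableU; exact: measurable_noise_failure.
have mscale m : measurable (scale m).
  apply: bigcup_measurable => i _; case: ifP => // _.
  exact: measurable_scale_failure.
have mbad m : measurable (bad m) by exact: measurableU.
have Pnoise m : (P (noise m.+1) <= (m.+1%:R * (4 * expR (- (3 * l m.+1))))%:E)%E.
  apply: union_bound_ord => i im.
    by apply: measurableU; exact: measurable_noise_failure.
  have b0 : 0 < 6 * l m.+1 by have := l1 m.+1 isT; lra.
  have -> : 4 * expR (- (3 * l m.+1)) =
      2 * expR (- (6 * l m.+1 / 2)) + 2 * expR (- (6 * l m.+1 / 2)) :> R.
    by rewrite (_ : 6 * l m.+1 / 2 = 3 * l m.+1); [ring|field].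
  apply: union_bound2; try exact: measurable_noise_failure.
    by apply: noise_failure_prob => // j; exact: eps_subgauss.
  by apply: noise_failure_prob => // j; exact: eps_subgauss.
have Pscale m : (P (scale m.+1) <= (m.+1%:R * (3 * expR (- (3 * l m.+1))))%:E)%E.
  apply: union_bound_ord => i im.
    by case: ifP => // _; exact: measurable_scale_failure.
  case: ifP => [adm|_].
    apply: scale_failure_prob => //; first by move=> j; exact: gamma_unif.
    - by move=> j; exact: U_unif.
    - exact: l1.
    - exact: ln_le_budget.
  by rewrite measure0 lee_fin mulr_ge0// expR_ge0.
have Pbad : (P (\bigcup_m bad m) <= delta%:E)%E.
  apply: (union_bound_nat mbad (c := fun m => delta / (m.+1%:R * m.+2%:R))).
    move=> m; apply: le_trans
      (union_bound2 (mnoise _) (mscale _) (Pnoise m) (Pscale m)) _.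
    rewrite lee_fin -mulrDr -mulrDl (_ : 4 + 3 = 7 :> R); last by ring.
    exact: budget_failure.
  by move=> n; apply: sum_telescope_le; exact: ltW.
have [_ _ run_ae] := OSE.
have gamma_ae : {ae P, forall w, forall a, 0 < gamma a.+1 w <= 1}.
  by apply: ae_foralln => a; apply: uniform01_ae; exact: gamma_unif.
have U_ae : {ae P, forall w, forall a, 0 < U a.+1 w <= 1}.
  by apply: ae_foralln => a; apply: uniform01_ae; exact: U_unif.
have [N [mN N0 NP]] := filterI run_ae (filterI gamma_ae U_ae).
have mB : measurable (\bigcup_m bad m) by exact: bigcup_measurable.
exists (~` (N `|` \bigcup_m bad m)); split.
- by apply: measurableC; exact: measurableU.
- rewrite probability_setC; last exact: measurableU.
  rewrite EFinB; apply: leeB => //.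
  rewrite -[delta%:E]add0e -[X in (X + _)%E]N0.
  by apply: le_trans (measureU2 _ mN mB) _; rewrite leeD2l.
move=> w /= /not_orP[Nw Bw] t t0.
have [run [gw Uw]] : [/\ OSE_path zeta (fun t => 6 * l t)
      (reward lambda gamma eps w) (U ^~ w) (ahat ^~ w) (rhat ^~ w) &
    (forall a, 0 < gamma a.+1 w <= 1) /\ (forall a, 0 < U a.+1 w <= 1)].
  by apply: contrapT => h; apply: Nw; apply: NP => -[h1 [h2 h3]]; apply: h.
have gI a : (0 < a)%N -> 0 < gamma a w <= 1 by case: a.
have U1 s : (0 < s)%N -> U s w <= 1 by case: s => // s _; case/andP: (Uw s).
have l_le s s' : (0 < s <= s')%N -> l s <= l s' by exact: budget_le.
have ahatP s : (0 < s)%N -> (1 <= ahat s w <= s)%N.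
  move=> s0; have [[/= /andP[-> ps] _] _ _] := run s s0.
  by rewrite (leq_trans ps)// scope_le// U1.
have conc a s : (0 < npulls (ahat ^~ w) a s)%N ->
    `|emp_mean (reward lambda gamma eps w) (ahat ^~ w) a s - lambda (gamma a w)|
      <= width zeta (fun t => 6 * l t) (ahat ^~ w) a s.
  move=> n0; have /andP[a1 as_] := npulls_gt0 ahatP n0.
  have ns := npulls_le (ahat ^~ w) a s.
  set n := npulls (ahat ^~ w) a s in n0 ns *.
  (* The confidence interval of an arm with [n] pulls is controlled at the
     first time at which the arm [a] may have been pulled [n] times. *)
  pose m := maxn a n.
  have m0 : (0 < m)%N by rewrite leq_max a1.
  apply: (@emp_mean_deviation _ _ _ _ (fun a i => eps a i w) _ _ _ _ m) => //.
    rewrite ler_pM2l//; apply: l_le.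
    by rewrite m0 geq_max as_ ns.
  rewrite ltNge; apply/negP => hn; apply: Bw; exists m.-1 => //; left.
  rewrite prednK//.
  have [an|na] := leqP a n.
    have mE : m = n by exact/maxn_idPr.
    exists a.-1; first by rewrite /= mE prednK.
    by left; rewrite prednK// /noise_failure /= -/n mE in hn *.
  have mE : m = a by apply/maxn_idPl; exact: ltnW.
  exists n.-1; first by rewrite /= mE prednK// ltnW.
  by right; rewrite prednK// /noise_failure /= mE in hn *.
have scales J : 2 ^+ 28 * l t ^+ 4 * 2 ^+ J <= t%:R ->
    good_scale (l t) J t (gamma ^~ w) (U ^~ w).
  move=> adm; apply: scale_failureN => hf; apply: Bw; exists t.-1 => //; right.
  rewrite prednK//; exists J; last by rewrite adm.
  (* Only the scales with 2^J <= t matter, so that J < t. *)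
  rewrite /=; apply: leq_trans (ltn_expl J (ltnSn 1)) _.
  rewrite -(ler_nat R) natrX; apply: le_trans adm.
  rewrite ler_peMl ?exprn_ge0// -[leLHS]mulr1 ler_pM//.
    by rewrite exprn_ege1// ler1n.
  by rewrite exprn_ege1// l1.
have rank_le eta : reachable zeta lambda (psi t) t eta -> gamma (rhat t w) w <= eta.
  apply: (@recommendation_rank _ zeta lambda l (gamma ^~ w) (U ^~ w)
    (reward lambda gamma eps w) (ahat ^~ w) (rhat ^~ w)) => //.
  - by move=> s; exact: l_le.
  - exact: ln_le_budget.
  - exact: l1.
  - exact: psi_ge.
have [_ _ [/= r1 _]] := run t t0.
have /andP[g0 g1] := gI _ r1.
have [le1 leeta] : eta_star zeta lambda (psi t) t <= 1 /\
    gamma (rhat t w) w <= eta_star zeta lambda (psi t) t.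
  rewrite /eta_star; case: asboolP => [_|/eqP/set0P[eta reta]]; first by split.
  split; last by apply: lb_le_inf; [exists eta|move=> y; exact: rank_le].
  apply: (@le_trans _ _ eta); last by case: reta => /andP[_ /ltW].
  by apply: ge_inf => //; exists 0 => y -[/andP[/ltW]].
by split=> //; apply: lambda_noninc.
Qed.
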